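(* There is an algorithm which, given integers $1\le k\le n$, a diagonal matrix $D\in\mathbb{R}^{n\times n}$ with real entries and matrices $U,V\in\mathbb{C}^{n\times k}$, computes an upper Hessenberg matrix $H=QAQ^*$, with $Q\in\mathbb{C}^{n\times n}$ unitary, where $A=D+UV^*$, using $O(n^2k)$ arithmetic operations (with the constant in $O(\cdot)$ independent of $n$, $k$, $D$, $U$, $V$).
   Context: $V^*$ denotes the Hermitian (conjugate) transpose. A matrix $H=(h_{i,j})$ is upper Hessenberg if $h_{i,j}=0$ for $i>j+1$. Cost is counted in exact arithmetic operations (ops) on complex numbers, where the square roots needed to form Givens rotations count as operations. The input is given as the diagonal of $D$ and the entries of $U$ and $V$. *)

(* Defs.v *)
From HB Require Import structures.
From mathcomp Require Import all_boot all_order all_algebra.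
From mathcomp Require Import spectral complex reals.
Set Implicit Arguments.
Unset Strict Implicit.
Unset Printing Implicit Defensive.
Import Order.TTheory GRing.Theory Num.Theory.
Local Open Scope ring_scope.

(* Model of computation: programs for a random access machine with           *)
(* - integer registers, holding natural numbers and used for loop counters,  *)
(*   loop bounds and array indices;                                          *)
(* - arrays of complex numbers with two indices, unbounded, zero by default. *)
(* A program is a finite syntax tree mentioning no complex number except the *)
(* literals 0 and 1; in particular it does not depend on the size of its     *)
(* input. No complex number can be turned into an integer: complex data act  *)
(* on the integer registers and on the control flow through the tests CIf    *)
(* only. All programs terminate, a loop bound being evaluated once, on entry.*)
(*                                                                           *)
(* Cost: each operation and each test on complex numbers costs 1. Control of *)
(* integer registers, literals and copies of complex cells are free.         *)

Inductive iexp : Type :=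
| IVar of nat
| ILit of nat
| IAdd of iexp & iexp
| ISub of iexp & iexp
| IMul of iexp & iexp
| IDiv of iexp & iexp.

Inductive unop : Type := UOpp | UConj | USqrt.

Inductive binop : Type := BAdd | BSub | BMul | BDiv.

Inductive ctest : Type := CEq | CLe.

(* CCell a i j is the entry (i, j) of the array number a *)
Inductive cexp : Type :=
| CZero
| COne
| CCell of nat & iexp & iexp
| CUn of unop & cexp
| CBin of binop & cexp & cexp.

Inductive cmd : Type :=
| Skip
| Seq of cmd & cmd
| ISet of nat & iexp
| CSet of nat & iexp & iexp & cexp
| IIf of iexp & iexp & cmd & cmd            (* if e1 <= e2 then _ else _ *)
| CIf of ctest & cexp & cexp & cmd & cmd
| For of nat & iexp & cmd.                  (* for x = 0, ..., e - 1 do _ *)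

Record state (C : Type) : Type := State {
  ireg : nat -> nat;
  cell : nat -> nat -> nat -> C;
  ops : nat  (* complex operations and tests performed so far *)
}.

Definition set_ireg (C : Type) (s : state C) (x v : nat) : state C :=
  State (fun y => if y == x then v else ireg s y) (cell s) (ops s).

Definition set_cell (C : Type) (s : state C) (a i j : nat) (z : C) : state C :=
  State (ireg s)
    (fun a' i' j' => if [&& a' == a, i' == i & j' == j] then z
                     else cell s a' i' j')
    (ops s).

Definition charge (C : Type) (s : state C) (t : nat) : state C :=
  State (ireg s) (cell s) (ops s + t)%N.

Fixpoint ieval (r : nat -> nat) (e : iexp) : nat :=
  match e with
  | IVar x => r x
  | ILit m => m
  | IAdd e1 e2 => (ieval r e1 + ieval r e2)%N
  | ISub e1 e2 => (ieval r e1 - ieval r e2)%N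
  | IMul e1 e2 => (ieval r e1 * ieval r e2)%N
  | IDiv e1 e2 => (ieval r e1 %/ ieval r e2)%N
  end.

(* Only square roots of nonnegative reals are available, as is needed to     *)
(* form Givens rotations; other square roots, like divisions by 0, yield 0.  *)
Definition unop_eval (C : numClosedFieldType) (o : unop) (x : C) : C :=
  match o with
  | UOpp => - x
  | UConj => x^*
  | USqrt => if 0 <= x then sqrtC x else 0
  end.

Definition binop_eval (C : numClosedFieldType) (o : binop) (x y : C) : C :=
  match o with
  | BAdd => x + y
  | BSub => x - y
  | BMul => x * y
  | BDiv => x / y
  end.

(* On complex numbers, x <= y means that y - x is a nonnegative real *)
Definition ctest_eval (C : numClosedFieldType) (o : ctest) (x y : C) : bool :=
  match o with
  | CEq => x == y
  | CLe => x <= y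
  end.

Fixpoint ceval (C : numClosedFieldType) (s : state C) (e : cexp) : C :=
  match e with
  | CZero => 0
  | COne => 1
  | CCell a i j => cell s a (ieval (ireg s) i) (ieval (ireg s) j)
  | CUn o e1 => unop_eval o (ceval s e1)
  | CBin o e1 e2 => binop_eval o (ceval s e1) (ceval s e2)
  end.

Fixpoint ccost (e : cexp) : nat :=
  match e with
  | CZero | COne | CCell _ _ _ => 0
  | CUn _ e1 => (ccost e1).+1
  | CBin _ e1 e2 => (ccost e1 + ccost e2).+1
  end.

Fixpoint exec (C : numClosedFieldType) (c : cmd) (s : state C) {struct c} :
    state C :=
  match c with
  | Skip => s
  | Seq c1 c2 => exec c2 (exec c1 s)
  | ISet x e => set_ireg s x (ieval (ireg s) e)
  | CSet a i j e =>
      charge (set_cell s a (ieval (ireg s) i) (ieval (ireg s) j) (ceval s e))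
             (ccost e)
  | IIf e1 e2 c1 c2 =>
      if (ieval (ireg s) e1 <= ieval (ireg s) e2)%N then exec c1 s
      else exec c2 s
  | CIf o e1 e2 c1 c2 =>
      let s' := charge s (ccost e1 + ccost e2).+1 in
      if ctest_eval o (ceval s e1) (ceval s e2) then exec c1 s' else exec c2 s'
  | For x e c1 =>
      foldl (fun s' i => exec c1 (set_ireg s' x i)) s
            (iota 0 (ieval (ireg s) e))
  end.

(* Conventions for input and output: registers 0 and 1 contain n and k;      *)
(* column 0 of array 0 contains the diagonal of D, arrays 1 and 2 contain U  *)
(* and V, and the result is read in array 3. Everything else is 0 initially. *)
Definition vec_cell (C : numClosedFieldType) (n : nat) (d : 'rV[C]_n)
    (i j : nat) : C :=
  if insub i is Some i' then (if j == 0%N then d ord0 i' else 0) else 0.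

Definition mx_cell (C : numClosedFieldType) (m n : nat) (M : 'M[C]_(m, n))
    (i j : nat) : C :=
  match insub i, insub j with
  | Some i', Some j' => M i' j'
  | _, _ => 0
  end.

Definition init (C : numClosedFieldType) (n k : nat) (d : 'rV[C]_n)
    (U V : 'M[C]_(n, k)) : state C :=
  State
    (fun x => match x with 0 => n | 1 => k | _ => 0 end)
    (fun a => match a with
              | 0 => vec_cell d
              | 1 => mx_cell U
              | 2 => mx_cell V
              | _ => fun _ _ => 0
              end)
    0.

Definition output (C : numClosedFieldType) (n : nat) (s : state C) : 'M[C]_n :=
  \matrix_(i < n, j < n) cell s 3 i j.

Definition upper_hessenberg (C : numClosedFieldType) (n : nat) (H : 'M[C]_n) :
    Prop :=
  forall i j : 'I_n, (j.+1 < i)%N -> H i j = 0.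

(* Main.v *)
Require Import Defs.
From HB Require Import structures.
From mathcomp Require Import all_boot all_order all_algebra.
From mathcomp Require Import spectral complex reals.
From mathcomp Require Import zify ring.
Set Implicit Arguments.
Unset Strict Implicit.
Unset Printing Implicit Defensive.
Import Order.TTheory GRing.Theory Num.Theory.
Local Open Scope ring_scope.
Local Open Scope sesquilinear_scope.

(** The algorithm is Arnoldi's iteration applied to A, which builds an
    orthonormal basis [q_1, q_2, ...] such that [A q_i] lies in the span of
    [q_1, ..., q_(i+1)]; in such a basis A is upper Hessenberg. In general a step
    orthogonalizes a vector against all previous ones, which takes [n ^ 3]
    operations in total. Here, since D is real, [A - A^*] is [U V^* - V U^*]:
    the entries of H above the superdiagonal are determined by the coefficients
    [q_i^* U] and [q_i^* V] ([hess_entry_skew]), and the projection of [A q_j]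
    onto the span of [q_1, ..., q_(j-2)] by the projections of U and V. If P is the
    projection onto the current span, updating [(1 - P) U] and [(1 - P) V] at
    each step therefore yields [(1 - P) A q_j] with a number of operations
    proportional to [n k] ([short_recurrence], [arnoldi_append]).

    When [(1 - P) A q_j = 0] the iteration restarts from a nonzero column of
    [(1 - P) U] or [(1 - P) V]. If there is none, P commutes with D
    ([proj_comm]), but may differ from 1 when D has repeated entries. To exclude
    this, Givens rotations are first applied to the rows of the matrix [U V]
    that share the same entry of D ([exec_deflate]); they commute with D,
    and leave for each value of D nonzero rows in echelon form, hence
    independent, and zero rows. The unit vector of a zero row is an eigenvector
    of A, and the basis starts with all of these. A span which contains them and
    the columns of [U] and [V], and whose projection commutes with D, is then
    the whole space ([echelon_kernel], [arnoldi_complete]), so that the iteration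
    does produce [n] vectors ([exec_extend]).

    The cost is bounded on the syntax of the program, separately from what it
    computes ([exec_cost], [hessenberg_reduction_cost]). *)

(** * Reasoning about programs *)

Fixpoint arrays_of (c : cmd) : seq nat :=
  match c with
  | Seq c1 c2 | IIf _ _ c1 c2 | CIf _ _ _ c1 c2 => arrays_of c1 ++ arrays_of c2
  | CSet a _ _ _ => [:: a]
  | For _ _ c1 => arrays_of c1
  | _ => [::]
  end.

Fixpoint regs_of (c : cmd) : seq nat :=
  match c with
  | Seq c1 c2 | IIf _ _ c1 c2 | CIf _ _ _ c1 c2 => regs_of c1 ++ regs_of c2
  | ISet x _ => [:: x]
  | For x _ c1 => x :: regs_of c1
  | _ => [::]
  end.

(** In the programs below every loop bound is at most a sum of literals and of
    registers 0 and 1, which are never overwritten, so that the cost can be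
    bounded by recursion on the syntax, independently of what the program computes. The bound is
    meaningful for the commands satisfying [cost_boundable]. *)
Fixpoint iexp_bound (n k : nat) (e : iexp) : nat :=
  match e with
  | IVar x => if x is 0 then n else k
  | ILit m => m
  | IAdd e1 e2 => (iexp_bound n k e1 + iexp_bound n k e2)%N
  | ISub e1 _ => iexp_bound n k e1
  | _ => 0
  end.

Fixpoint iexp_boundable (e : iexp) : bool :=
  match e with
  | IVar x => (x < 2)%N
  | ILit _ => true
  | IAdd e1 e2 => iexp_boundable e1 && iexp_boundable e2
  | ISub e1 _ => iexp_boundable e1
  | _ => false
  end.

Fixpoint cost_bound (n k : nat) (c : cmd) : nat :=
  match c with
  | Skip | ISet _ _ => 0
  | Seq c1 c2 | IIf _ _ c1 c2 => (cost_bound n k c1 + cost_bound n k c2)%N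
  | CSet _ _ _ e => ccost e
  | CIf _ e1 e2 c1 c2 =>
      ((ccost e1 + ccost e2).+1 + (cost_bound n k c1 + cost_bound n k c2))%N
  | For _ e c1 => (iexp_bound n k e * cost_bound n k c1)%N
  end.

Fixpoint cost_boundable (c : cmd) : bool :=
  match c with
  | Seq c1 c2 | IIf _ _ c1 c2 | CIf _ _ _ c1 c2 =>
      cost_boundable c1 && cost_boundable c2
  | ISet x _ => (1 < x)%N
  | For x e c1 => [&& (1 < x)%N, iexp_boundable e & cost_boundable c1]
  | _ => true
  end.

Section Semantics.
Variable C : numClosedFieldType.
Implicit Types (s : state C) (c : cmd) (e : cexp).

Lemma for_ind (P : nat -> state C -> Prop) x b c s :
    P 0%N s ->
    (forall i s', (i < ieval (ireg s) b)%N -> P i s' ->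
       P i.+1 (exec c (set_ireg s' x i))) ->
  P (ieval (ireg s) b) (exec (For x b c) s).
Proof.
move=> P0 Pstep /=.
set m := ieval _ b in Pstep *.
have: (m <= m)%N by [].
elim: {-2}m => [|i IHi] lt_im; first by [].
by rewrite -(addn1 i) iotaD foldl_cat addn1 /=; apply/Pstep/IHi/ltnW.
Qed.

Lemma exec_seq c1 c2 s : exec (Seq c1 c2) s = exec c2 (exec c1 s).
Proof. by []. Qed.

Lemma exec_iif b1 b2 c1 c2 s : exec (IIf b1 b2 c1 c2) s =
  if (ieval (ireg s) b1 <= ieval (ireg s) b2)%N then exec c1 s else exec c2 s.
Proof. by []. Qed.

Lemma exec_reg c s y : y \notin regs_of c -> ireg (exec c s) y = ireg s y.
Proof.
elim: c s => //= [c1 IH1 c2 IH2|x e|e1 e2 c1 IH1 c2 IH2|o e1 e2 c1 IH1 c2 IH2|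
                 x e c1 IH1] s.
- by rewrite mem_cat => /norP[? ?]; rewrite IH2 // IH1.
- by rewrite inE => /negPf ->.
- by rewrite mem_cat => /norP[? ?]; case: ifP => _; rewrite ?IH1 ?IH2.
- by rewrite mem_cat => /norP[? ?]; case: ifP => _; rewrite ?IH1 ?IH2.
rewrite inE => /norP[/negPf neq_yx y_c1].
apply: (for_ind (P := fun _ s' => ireg s' y = ireg s y)) => // i s' _ <-.
by rewrite IH1 //= neq_yx.
Qed.

Lemma exec_array c s a i j :
  a \notin arrays_of c -> cell (exec c s) a i j = cell s a i j.
Proof.
elim: c s => //= [c1 IH1 c2 IH2|b e1 e2 e|e1 e2 c1 IH1 c2 IH2|
                  o e1 e2 c1 IH1 c2 IH2|x e c1 IH1] s.
- by rewrite mem_cat => /norP[? ?]; rewrite IH2 // IH1.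
- by rewrite inE => /negPf ->.
- by rewrite mem_cat => /norP[? ?]; case: ifP => _; rewrite ?IH1 ?IH2.
- by rewrite mem_cat => /norP[? ?]; case: ifP => _; rewrite ?IH1 ?IH2.
move=> a_c1.
by apply: (for_ind (P := fun _ s' => _ s' a i j = _)) => // i' s' _ <-; rewrite IH1.
Qed.

Lemma ieval_bound n k s b :
    ireg s 0 = n -> ireg s 1 = k -> iexp_boundable b ->
  (ieval (ireg s) b <= iexp_bound n k b)%N.
Proof.
move=> rn rk; elim: b => //=.
- by case=> [|[|x]] //= _; rewrite ?rn ?rk.
- by move=> b1 IH1 b2 IH2 /andP[b1P b2P]; rewrite leq_add ?IH1 ?IH2.
by move=> b1 IH1 b2 _ b1P; rewrite (leq_trans (leq_subr _ _)) ?IH1.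
Qed.

Lemma cost_boundable_reg c s y :
  cost_boundable c -> (y < 2)%N -> ireg (exec c s) y = ireg s y.
Proof.
move=> cP y_lt2; apply: exec_reg.
elim: c cP => //= [c1 IH1 c2 IH2|x e|e1 e2 c1 IH1 c2 IH2|
                   o e1 e2 c1 IH1 c2 IH2|x e c1 IH1].
- by rewrite mem_cat negb_or => /andP[/IH1 -> /IH2 ->].
- by rewrite inE; lia.
- by rewrite mem_cat negb_or => /andP[/IH1 -> /IH2 ->].
- by rewrite mem_cat negb_or => /andP[/IH1 -> /IH2 ->].
by rewrite inE negb_or => /and3P[x_gt1 _ /IH1 ->]; rewrite andbT; lia.
Qed.

Lemma exec_cost c s :
    cost_boundable c ->
  (ops (exec c s) <= ops s + cost_bound (ireg s 0) (ireg s 1) c)%N.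
Proof.
elim: c s => //= [|c1 IH1 c2 IH2|x e|e1 e2 c1 IH1 c2 IH2|
                  o e1 e2 c1 IH1 c2 IH2|x e c1 IH1] s.
- by rewrite addn0.
- move=> /andP[c1P c2P]; have := IH2 (exec c1 s) c2P; have := IH1 s c1P.
  by rewrite !cost_boundable_reg //; lia.
- by rewrite addn0.
- move=> /andP[c1P c2P]; have := IH2 s c2P; have := IH1 s c1P.
  by case: ifP => _; lia.
- move=> /andP[c1P c2P].
  set s1 := charge s _; have := IH2 s1 c2P; have := IH1 s1 c1P.
  by case: ifP => _ /=; lia.
case/and3P=> x_gt1 eP c1P.
have x_neq y : (y < 2)%N -> (y == x) = false by lia.
set B := cost_bound _ _ c1; set m := iexp_bound _ _ e.
suff: [/\ ireg (exec (For x e c1) s) 0 = ireg s 0,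
          ireg (exec (For x e c1) s) 1 = ireg s 1
        & (ops (exec (For x e c1) s) <= ops s + ieval (ireg s) e * B)%N].
  case=> _ _ /leq_trans; apply; rewrite leq_add2l leq_mul2r.
  by rewrite ieval_bound ?orbT.
apply: (for_ind (P := fun i s' => [/\ ireg s' 0 = ireg s 0, ireg s' 1 = ireg s 1
                                   & (ops s' <= ops s + i * B)%N])).
  by rewrite addn0.
move=> i s' _ [r0 r1 s'B]; rewrite !cost_boundable_reg //= !x_neq //.
split=> //; apply: leq_trans (IH1 _ c1P) _.
by rewrite /= !x_neq // r0 r1 -/B mulSn; lia.
Qed.

Definition sum_loop (a : nat) (ie je : iexp) (x : nat) (b : iexp) (e : cexp) :=
  Seq (CSet a ie je CZero)
      (For x b (CSet a ie je (CBin BAdd (CCell a ie je) e))).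

(** The states [s'] are those in which the summand is evaluated: only the loop
    register and the cell of the partial sum may differ from the initial ones.
    The same convention is used for [exec_fill_loop], where the part of the
    column filled so far may differ. *)
Lemma exec_sum_loop a ie je x b e s (f : nat -> C) I J m :
    ieval (ireg s) b = m ->
    (forall s', (forall y, y != x -> ireg s' y = ireg s y) ->
       ieval (ireg s') ie = I /\ ieval (ireg s') je = J) ->
    (forall v s', (v < m)%N ->
       (forall y, ireg s' y = if y == x then v else ireg s y) ->
       (forall a' i j, ~~ [&& a' == a, i == I & j == J] ->
          cell s' a' i j = cell s a' i j) ->
       ceval s' e = f v) ->
  forall a' i j, cell (exec (sum_loop a ie je x b e) s) a' i j =
    if [&& a' == a, i == I & j == J] then \sum_(v < m) f v else cell s a' i j.
Proof.
move=> mE IJ ef.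
have [Is Js] := IJ s (fun _ _ => erefl).
set s1 := exec (CSet a ie je CZero) s.
pose P v s' := (forall y, y != x -> ireg s' y = ireg s y) /\
  forall a' i j, cell s' a' i j =
    if [&& a' == a, i == I & j == J] then \sum_(w < v) f w else cell s a' i j.
suff [_ ?]: P m (exec (sum_loop a ie je x b e) s) by [].
have <- : ieval (ireg s1) b = m by [].
apply: (@for_ind P x b (CSet a ie je _) s1); first by split=> // a' i j; rewrite big_ord0 /= Is Js.
rewrite mE => v s' lt_vm [rs' cs'].
set s2 := set_ireg s' x v.
have rs2 y : y != x -> ireg s2 y = ireg s y by move=> /[dup] /rs' <- /negPf /= ->.
have [Is2 Js2] := IJ s2 rs2.
split=> [y|a' i j] /=; first exact: rs2.
rewrite -/(ireg s2) Is2 Js2; case: ifP => [_|aij]; last by rewrite cs' aij.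
rewrite big_ord_recr /= cs' !eqxx (ef v s2) // => [y /=|b' i' j' /negPf nb].
  by case: eqP => // /eqP /rs'.
by rewrite /= cs' nb.
Qed.

Definition fill_loop (a x : nat) (b je : iexp) (e : cexp) :=
  For x b (CSet a (IVar x) je e).

Lemma exec_fill_loop a x b je e s (f : nat -> C) J m :
    ieval (ireg s) b = m ->
    (forall s', (forall y, y != x -> ireg s' y = ireg s y) ->
       ieval (ireg s') je = J) ->
    (forall v s', (v < m)%N ->
       (forall y, ireg s' y = if y == x then v else ireg s y) ->
       (forall a' i j, ~~ [&& a' == a, (i < v)%N & j == J] ->
          cell s' a' i j = cell s a' i j) ->
       ceval s' e = f v) ->
  forall a' i j, cell (exec (fill_loop a x b je e) s) a' i j =
    if [&& a' == a, (i < m)%N & j == J] then f i else cell s a' i j.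
Proof.
move=> mE JP ef.
pose P v s' := (forall y, y != x -> ireg s' y = ireg s y) /\
  forall a' i j, cell s' a' i j =
    if [&& a' == a, (i < v)%N & j == J] then f i else cell s a' i j.
suff [_ ?]: P m (exec (fill_loop a x b je e) s) by [].
rewrite -{}mE in ef *.
apply: (@for_ind P x b _ s); first by split=> // a' i j; rewrite ltn0 andbF.
move=> v s' lt_vm [rs' cs'].
set s2 := set_ireg s' x v.
have rs2 y : y != x -> ireg s2 y = ireg s y by move=> /[dup] /rs' <- /negPf /= ->.
split=> [y|a' i j] /=; first exact: rs2.
rewrite -/(ireg s2) (JP s2 rs2) /= eqxx ltnS leq_eqVlt.
rewrite (ef v s2) // => [|y /=|b' i' j' /negPf nb].
- rewrite cs'; have [->|_] := eqVneq i v; last by rewrite /= andbF.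
  by rewrite ltnn andbF /=; case: ifP.
- by case: eqP => // /eqP /rs'.
by rewrite /= cs' nb.
Qed.

End Semantics.

(** * Orthonormal sequences with the Hessenberg property *)

Section Adjoint.
Variable C : numClosedFieldType.

Lemma adjM m n p (A : 'M[C]_(m, n)) (B : 'M_(n, p)) :
  (A *m B)^t* = B^t* *m A^t*.
Proof. by rewrite trmx_mul map_mxM. Qed.

Lemma adjD m n (A B : 'M[C]_(m, n)) : (A + B)^t* = A^t* + B^t*.
Proof. by rewrite linearD map_mxD. Qed.

Lemma adj0 m n : (0 : 'M[C]_(m, n))^t* = 0.
Proof. by rewrite trmx0 map_mx0. Qed.

Lemma adj_sum m n (I : Type) (r : seq I) (P : pred I) (F : I -> 'M[C]_(m, n)) :
  (\sum_(i <- r | P i) F i)^t* = \sum_(i <- r | P i) (F i)^t*.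
Proof. exact: (big_morph (fun M : 'M_(m, n) => M^t*) (@adjD m n) (adj0 m n)). Qed.

End Adjoint.

Section Hessenberg.
Variables (C : numClosedFieldType) (n : nat).
Implicit Types (v : nat -> 'cV[C]_n) (A P : 'M[C]_n) (q x : 'cV[C]_n).

(** The orthogonal projection onto the span of the first [j] vectors. The
    sequence starts at index 1, so that index 0 can hold a zero vector standing
    for the missing predecessor of the first vector in the three-term part of
    the recurrence below. *)
Definition proj v j : 'M[C]_n := \sum_(i < j) v i.+1 *m (v i.+1)^t*.

(** By the last condition the image of each vector but the last one lies in the
    span of its predecessors, itself and its successor, which makes the matrix
    of [A] in this basis upper Hessenberg. *)
Definition hess_basis A v j : Prop :=
  [/\ v 0%N = 0,
      forall a b, (a < j)%N -> (b < j)%N ->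
        (v a.+1)^t* *m v b.+1 = (a == b)%:R%:M
    & forall i, (i < j)%N -> A *m v i = proj v i.+1 *m (A *m v i)].

Lemma projS v j : proj v j.+1 = proj v j + v j.+1 *m (v j.+1)^t*.
Proof. by rewrite /proj big_ord_recr. Qed.

Lemma proj_adj v j : (proj v j)^t* = proj v j.
Proof.
by rewrite adj_sum; apply: eq_bigr => i _; rewrite adjM trmxCK.
Qed.

Lemma adj_mul_proj0 v j q : proj v j *m q = 0 -> q^t* *m proj v j = 0.
Proof. by move=> Pq0; rewrite -(proj_adj v j) -adjM Pq0 adj0. Qed.

Lemma eq_proj v v' j :
  (forall i, (i <= j)%N -> v i = v' i) -> proj v j = proj v' j.
Proof. by move=> eqv; apply: eq_bigr => i _; rewrite eqv. Qed.

Lemma eq_hess_basis A v v' j :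
  (forall i, (i <= j)%N -> v i = v' i) -> hess_basis A v j -> hess_basis A v' j.
Proof.
move=> eqv [v0 ortho hess]; split=> [|a b a_lt b_lt|i i_lt].
- by rewrite -eqv.
- by rewrite -!eqv //; apply: ortho.
rewrite -(eqv i (ltnW i_lt)) -(@eq_proj v v'); first exact: hess.
by move=> l l_le; apply/eqv/(leq_trans l_le).
Qed.

Section Projection.
Variables (A : 'M[C]_n) (v : nat -> 'cV[C]_n) (j : nat).
Hypothesis basis : hess_basis A v j.

Let ortho a b : (a < j)%N -> (b < j)%N ->
  (v a.+1)^t* *m v b.+1 = (a == b)%:R%:M.
Proof. by case: basis => _ + _ => /[apply] /[apply]. Qed.

Lemma proj_id i : (i <= j)%N -> proj v j *m v i = v i.
Proof.
case: i => [_|i lt_ij]; first by case: basis => -> _ _; rewrite mulmx0.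
rewrite /proj mulmx_suml (bigD1 (Ordinal lt_ij)) //= big1 => [|l ne_l].
  by rewrite addr0 -mulmxA ortho // eqxx mulmx1.
rewrite -mulmxA ortho //; case: eqP => [eq_l|_].
  by case/eqP: ne_l; apply/val_inj.
by rewrite mul_mx_scalar scale0r.
Qed.

Lemma projK i : (i <= j)%N -> proj v j *m proj v i = proj v i.
Proof.
move=> le_ij; rewrite /proj mulmx_sumr; apply: eq_bigr => l _.
by rewrite mulmxA proj_id // (leq_trans _ le_ij).
Qed.

Lemma adj_proj_id i : (i <= j)%N -> (v i)^t* *m proj v j = (v i)^t*.
Proof. by move=> le_ij; rewrite -{1}proj_adj -adjM proj_id. Qed.

Lemma hess_basis_ortho q i :
  proj v j *m q = 0 -> (i <= j)%N -> (v i)^t* *m q = 0.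
Proof. by move=> Pq0 le_ij; rewrite -adj_proj_id // -mulmxA Pq0 mulmx0. Qed.

Lemma proj1_size : proj v j = 1%:M -> j = n.
Proof.
move=> /(congr1 mxtrace); rewrite mxtrace1 raddf_sum /=.
rewrite (eq_bigr (fun=> 1)) => [|i _]; last first.
  by rewrite mxtrace_mulC ortho // eqxx mxtrace_scalar.
by rewrite sumr_const card_ord => /eqP; rewrite eqr_nat => /eqP.
Qed.

End Projection.

(** Either the next vector is the normalized residual, so that it makes the
    residual vanish, or the span is already invariant; in both cases the last
    image falls into the enlarged span. *)
Lemma hess_basisS A v j :
    hess_basis A v j -> proj v j *m v j.+1 = 0 ->
    (v j.+1)^t* *m v j.+1 = 1%:M ->
    (exists a, A *m v j - proj v j *m (A *m v j) = a *: v j.+1) ->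
  hess_basis A v j.+1.
Proof.
move=> vP Pq0 q1 [a resE]; case: (vP) => v0 ortho hess.
have vq i : (i <= j)%N -> (v i)^t* *m v j.+1 = 0.
  exact: (hess_basis_ortho vP Pq0).
split=> // [b c|i]; rewrite !ltnS => b_le.
  move=> c_le; have [->|b_ne] := eqVneq b j; have [->|c_ne] := eqVneq c j.
  - by rewrite q1.
  - have c_lt: (c < j)%N by lia.
    by rewrite -[v c.+1]trmxCK -adjM vq // adj0 raddf0.
  - have b_lt: (b < j)%N by lia.
    by rewrite (negPf b_ne) vq // raddf0.
  - by apply: ortho; lia.
move: b_le; rewrite leq_eqVlt => /predU1P[->|/hess //].
rewrite projS mulmxDl -[_ *m _ *m (A *m _)]mulmxA.
have -> : (v j.+1)^t* *m (A *m v j) = a%:M.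
  rewrite -[A *m v j](subrK (proj v j *m (A *m v j))) resE mulmxDr -scalemxAr q1.
  rewrite mulmxA adj_mul_proj0 // mul0mx addr0.
  by rewrite scale_scalar_mx mulr1.
by rewrite mul_mx_scalar -resE addrC subrK.
Qed.

(** Since A minus its adjoint is [U V^* - V U^*], the vector [z] is
    [(1 - P) A q + P A^* q]. The Hessenberg property makes [A^* q] orthogonal
    to all basis vectors but the last two, so that two inner products remove
    the unwanted part of [z]: this is what makes a step of the recurrence
    cost as many operations as a product by [U] and [V], instead of a
    projection onto the whole basis. *)
Lemma short_recurrence k (D : 'M[C]_n) (U V : 'M[C]_(n, k)) v j :
    let A := D + U *m V^t* in
    let P := proj v j.+1 in
    let q := v j.+1 in
    let z := D *m q + (U - P *m U) *m (V^t* *m q) + P *m V *m (U^t* *m q) in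
    D^t* = D -> hess_basis A v j.+1 ->
  z - q *m (q^t* *m z) - v j *m ((v j)^t* *m z) = A *m q - P *m (A *m q).
Proof.
move=> A P q z Dh vP; have [v0 ortho hess] := vP.
have P_id i : (i <= j.+1)%N -> (v i)^t* *m P = (v i)^t*.
  exact: (adj_proj_id vP).
have AhE : A^t* = D + V *m U^t* by rewrite adjD adjM trmxCK Dh.
have zE : z = A *m q - P *m (A *m q) + P *m (A^t* *m q).
  rewrite AhE /A !mulmxDl !mulmxDr /z mulmxBl !mulmxA.
  by rewrite opprD [- (P *m D *m q) - _]addrC !addrA subrK.
have PAh : P *m (A^t* *m q)
    = q *m (q^t* *m (A^t* *m q)) + v j *m ((v j)^t* *m (A^t* *m q)).
  rewrite /P projS mulmxDl -[_ *m _ *m (A^t* *m q)]mulmxA addrC; congr (_ + _).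
  case: j @P @q vP v0 ortho hess {z zE P_id} => [|j] P q vP v0 ortho hess.
    by rewrite /proj big_ord0 v0 !mul0mx.
  rewrite projS mulmxDl -[_ *m _ *m (A^t* *m q)]mulmxA.
  rewrite /proj mulmx_suml big1 ?add0r // => i _.
  rewrite -mulmxA [(v i.+1)^t* *m (_ *m _)]mulmxA -adjM hess; last first.
    by rewrite ltnS ltnW // ltnS ltn_ord.
  suff vq l : (l < i.+2)%N -> (v l.+1)^t* *m q = 0.
    rewrite adjM proj_adj -[_ *m _ *m q]mulmxA.
    rewrite [proj _ _ *m q]mulmx_suml big1 ?mulmx0 // => l _.
    by rewrite -mulmxA vq ?mulmx0.
  move=> l_lt; have lt_ij := ltn_ord i.
  rewrite ortho; try by lia.
  by rewrite (_ : (l == _) = false) ?raddf0 //; lia.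
have orth i : (i <= j.+1)%N -> (v i)^t* *m z = (v i)^t* *m (A^t* *m q).
  move=> i_le; rewrite zE mulmxDr mulmxBr !mulmxA P_id // subrr add0r.
  by rewrite -!mulmxA.
by rewrite (orth j.+1) // (orth j) // {1}zE PAh -[_ - v j *m _]addrA -opprD addrK.
Qed.

(** When the algorithm has nothing left to add, the range of [P] is invariant
    under the Hermitian matrix [D], hence reduces it. *)
Lemma proj_comm k (D : 'M[C]_n) (U V : 'M[C]_(n, k)) v j :
    let A := D + U *m V^t* in
    let P := proj v j in
    D^t* = D -> hess_basis A v j -> A *m v j = P *m (A *m v j) ->
    P *m U = U -> P *m D = D *m P.
Proof.
move=> A P Dh vP vj PU; have [_ _ hess] := vP.
have AP : A *m P = P *m (A *m P).
  rewrite /P {1 3}/proj !mulmx_sumr; apply: eq_bigr => i _.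
  rewrite !(mulmxA A) [RHS]mulmxA; congr (_ *m _).
  have [eq_ij|ne_ij] := eqVneq i.+1 j; first by rewrite eq_ij.
  have lt_ij : (i.+1 < j)%N by rewrite ltn_neqAle ne_ij ltn_ord.
  by rewrite hess // [RHS]mulmxA (projK vP).
have DP : D *m P = P *m D *m P.
  have := AP; rewrite /A mulmxDl mulmxDr !mulmxA PU => /addIr -> //.
by rewrite DP -[P in LHS]proj_adj -{1}Dh -adjM DP !adjM Dh proj_adj mulmxA.
Qed.

End Hessenberg.

Section Entries.
Variables (C : numClosedFieldType) (n k : nat).
Variables (D : 'M[C]_n) (U V : 'M[C]_(n, k)) (v : nat -> 'cV[C]_n) (j : nat).
Let A := D + U *m V^t*.
Hypotheses (D_herm : D^t* = D) (basis : hess_basis A v j).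

Lemma hess_entry0 a b : (a < j)%N -> (b.+1 < a)%N ->
  (v a.+1)^t* *m (A *m v b.+1) = 0.
Proof.
case: (basis) => _ ortho hess a_lt b_lt; rewrite hess; last by lia.
rewrite mulmxA -[_ *m proj _ _]trmxCK adjM proj_adj trmxCK.
rewrite /proj mulmx_suml big1 ?adj0 ?mul0mx // => i _; have := ltn_ord i => i_lt.
rewrite -mulmxA ortho; try by lia.
by rewrite (_ : (nat_of_ord i == a) = false) ?raddf0 //; lia.
Qed.

(** The mirror image of an entry above the superdiagonal vanishes, so that the
    entry is one of [A - A^*], that is of [U V^* - V U^*]: it takes a number of
    operations proportional to [k], not to [n]. *)
Lemma hess_entry_skew a b : (b < j)%N -> (a.+1 < b)%N ->
  (v a.+1)^t* *m (A *m v b.+1) =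
    ((v a.+1)^t* *m U) *m (V^t* *m v b.+1) - ((v a.+1)^t* *m V) *m (U^t* *m v b.+1).
Proof.
move=> b_lt a_lt; have := hess_entry0 b_lt a_lt.
move/(congr1 (fun M => M^t*)); rewrite adj0 !adjM trmxCK adjD adjM trmxCK D_herm.
move/eqP; rewrite /A !mulmxDl !mulmxDr mulmxDl addr_eq0 -!mulmxA => /eqP ->.
by rewrite addrC.
Qed.

End Entries.

Lemma unitary_columns (C : numClosedFieldType) n (v : nat -> 'cV[C]_n) :
    (forall a b, (a < n)%N -> (b < n)%N ->
       (v a.+1)^t* *m v b.+1 = (a == b)%:R%:M) ->
  (\matrix_(l < n, i < n) v i.+1 l 0)^t* \is unitarymx.
Proof.
move=> ortho; apply/unitarymxP; apply/matrixP=> a b.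
have := ortho a b (ltn_ord a) (ltn_ord b) => /(congr1 (fun M : 'M_1 => M 0 0)).
rewrite !mxE mulr1n => <-.
by apply: eq_bigr => l _; rewrite trmxCK !mxE.
Qed.

(** * Rotations of rows sharing a diagonal entry *)

Section Givens.
Variables (C : numClosedFieldType) (n : nat).
Implicit Types (a b : C) (p i : 'I_n).

Definition givens_mx a b p i : 'M[C]_n := \matrix_(x, y)
  if x == p then (if y == p then a^* else if y == i then b^* else 0)
  else if x == i then (if y == p then - b else if y == i then a else 0)
  else (x == y)%:R.

Lemma mul_givens_mx a b p i m (M : 'M[C]_(n, m)) x y : p != i ->
  (givens_mx a b p i *m M) x y =
    if x == p then a^* * M p y + b^* * M i y
    else if x == i then a * M i y - b * M p y else M x y.
Proof.
move=> ne_pi; have ne_ip : i != p by rewrite eq_sym.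
rewrite mxE; have [->|ne_xp] := eqVneq x p.
  rewrite (bigD1 p) //= (bigD1 i) //= big1 ?addr0 => [|z /andP[/negPf zp /negPf zi]].
    by rewrite !mxE !eqxx (negPf ne_ip).
  by rewrite !mxE eqxx zp zi mul0r.
have [->|ne_xi] := eqVneq x i.
  rewrite (bigD1 p) //= (bigD1 i) //= big1 ?addr0 => [|z /andP[/negPf zp /negPf zi]].
    by rewrite !mxE !eqxx (negPf ne_ip) mulNr addrC.
  by rewrite !mxE eqxx (negPf ne_ip) zp zi mul0r.
rewrite (bigD1 x) //= big1 ?addr0 => [|z ne_zx].
  by rewrite mxE (negPf ne_xp) (negPf ne_xi) eqxx mul1r.
by rewrite mxE (negPf ne_xp) (negPf ne_xi) eq_sym (negPf ne_zx) mul0r.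
Qed.

Lemma givens_unitary a b p i : p != i -> a * a^* + b * b^* = 1 ->
  givens_mx a b p i \is unitarymx.
Proof.
move=> ne_pi ab1; have ne_ip : i != p by rewrite eq_sym.
apply/unitarymxP; apply/matrixP=> x y; rewrite mul_givens_mx // !mxE.
have [->|ne_xp] := eqVneq x p; last have [->|ne_xi] := eqVneq x i.
- have [y_p|ne_yp] := eqVneq y p; last have [y_i|ne_yi] := eqVneq y i.
  + by rewrite ?eqxx (negPf ne_ip) !conjCK mulrC [b^* * _]mulrC ab1.
  + by rewrite ?eqxx (negPf ne_ip) rmorphN /=; ring.
  + by rewrite ?(negPf ne_yp) ?(negPf ne_yi) rmorph0 !mulr0 addr0.
- have [y_p|ne_yp] := eqVneq y p; last have [y_i|ne_yi] := eqVneq y i.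
  + by rewrite y_p ?eqxx (negPf ne_ip) !conjCK /=; ring.
  + by rewrite ?eqxx (negPf ne_ip) rmorphN /= mulrN opprK ab1.
  + by rewrite ?(negPf ne_yp) ?(negPf ne_yi) rmorph0 !mulr0 subr0.
have [y_p|ne_yp] := eqVneq y p; last have [y_i|ne_yi] := eqVneq y i.
- by rewrite y_p ?(negPf ne_xp) ?(negPf ne_xi) rmorph0.
- by rewrite y_i ?(negPf ne_xp) ?(negPf ne_xi) rmorph0.
by rewrite rmorph_nat eq_sym.
Qed.

Lemma givens_comm a b p i (d : 'rV[C]_n) : d 0 p = d 0 i ->
  givens_mx a b p i *m diag_mx d = diag_mx d *m givens_mx a b p i.
Proof.
move=> dE; apply/matrixP=> x y; rewrite mul_mx_diag mul_diag_mx !mxE mulrC.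
have [->|ne_xp] := eqVneq x p.
  have [->//|ne_yp] := eqVneq y p.
  by have [->|ne_yi] := eqVneq y i; rewrite ?dE // !mulr0.
have [->|ne_xi] := eqVneq x i.
  have [->|ne_yp] := eqVneq y p; first by rewrite dE.
  by have [->|ne_yi] := eqVneq y i; rewrite // !mulr0.
by have [->//|ne_xy] := eqVneq x y; rewrite !mulr0.
Qed.

End Givens.

(** * Deflation of repeated diagonal entries *)

Section Echelon.
Variable C : numClosedFieldType.

(** The rows of [x] belonging to one value of [d] are in echelon form, up to
    their order: [lead m c] means that row [m] has its first nonzero entry
    in column [c]. *)
Definition echelon (n K : nat) (d : nat -> C) (x : nat -> nat -> C)
    (lead : nat -> nat -> bool) : Prop :=
  [/\ forall m c, lead m c -> x m c != 0 /\ forall c', (c' < c)%N -> x m c' = 0,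
      forall m m' c, lead m c -> lead m' c -> d m = d m' -> m = m'
    & forall m, (m < n)%N ->
        (forall c, (c < K)%N -> x m c = 0) \/ exists2 c, (c < K)%N & lead m c].

(** A matrix commuting with [diag d] only combines rows of [x] that belong to
    the same value of [d], and those that are nonzero are linearly independent. *)
Lemma echelon_kernel n K d x lead (E : 'M[C]_n) :
    echelon n K d x lead ->
    (forall l m, d (val l) != d (val m) -> E l m = 0) ->
    (forall l c, (c < K)%N -> \sum_m E l m * x m c = 0) ->
    (forall l m : 'I_n, (forall c, (c < K)%N -> x m c = 0) -> E l m = 0) ->
  E = 0.
Proof.
move=> [leadP lead_inj lead_ex] Ed Ex E0; apply/matrixP=> l m; rewrite mxE.
have [xm0|[c c_lt lead_mc]] := lead_ex m (ltn_ord m); first exact: E0.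
elim/ltn_ind: c => c IHc in m c_lt lead_mc *.
have [dlm|] := eqVneq (d l) (d m); last exact: Ed.
have [xmc0 _] := leadP _ _ lead_mc; apply: (mulIf xmc0); rewrite mul0r.
have := Ex l c c_lt; rewrite (bigD1 m) //= big1 ?addr0 // => m' ne_m'm.
have [dlm'|/Ed ->] := eqVneq (d l) (d m'); last by rewrite mul0r.
have [xm0|[c' c'_lt lead_m'c']] := lead_ex m' (ltn_ord m').
  by rewrite xm0 ?mulr0.
have [c'c|cc'|eq_c] := ltngtP c' c.
- by rewrite (IHc c') // mul0r.
- by have [_ ->] := leadP _ _ lead_m'c'; rewrite ?mulr0.
case/eqP: ne_m'm; apply: val_inj; apply: lead_inj lead_mc _; last by rewrite -dlm'.
by rewrite -eq_c.
Qed.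

End Echelon.

(** * The program *)

Declare Scope iexp_scope.
Delimit Scope iexp_scope with ix.
Declare Scope cexp_scope.
Delimit Scope cexp_scope with cx.
Local Arguments IAdd _%_ix _%_ix.
Local Arguments ISub _%_ix _%_ix.
Local Arguments CCell _ _%_ix _%_ix.
Local Arguments CUn _ _%_cx.
Local Arguments CBin _ _%_cx _%_cx.
Local Arguments CSet _ _%_ix _%_ix _%_cx.
Local Arguments ISet _ _%_ix.
Local Arguments IIf _%_ix _%_ix _ _.
Local Arguments CIf _ _%_cx _%_cx _ _.
Local Arguments For _ _%_ix _.
Local Arguments sum_loop _ _%_ix _%_ix _ _%_ix _%_cx.
Local Arguments fill_loop _ _ _%_ix _%_ix _%_cx.

Local Notation "x + y" := (IAdd x y) : iexp_scope.
Local Notation "x - y" := (ISub x y) : iexp_scope.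

Local Notation "x + y" := (CBin BAdd x y) : cexp_scope.
Local Notation "x - y" := (CBin BSub x y) : cexp_scope.
Local Notation "x * y" := (CBin BMul x y) : cexp_scope.
Local Notation "x / y" := (CBin BDiv x y) : cexp_scope.
Local Notation conj x := (CUn UConj x).

(** Register [rJ] counts the basis vectors, [rM] holds an index found by a
    search and [rF] a flag; the others are loop counters. Arrays: [aX] is
    the matrix [U V] of size n x 2k, first as given and then after rotations of
    its rows, with the leading entries flagged in [aB]; column [i] of [aQ] is
    the basis vector number [i], counted from 1; [aF] contains the coefficients
    of the columns of [aX] on the basis; [aR] contains in its first 2k columns
    what the projection onto the span of the basis leaves of the columns of
    [aX], and in column 2k what it leaves of the image of the last vector;
    [aE] is the direction to be appended, [aW] and [aS] are scratch. *)
Local Notation rJ := 2%N.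
Local Notation rL := 3%N.
Local Notation rC := 4%N.
Local Notation rI := 5%N.
Local Notation rM := 6%N.
Local Notation rF := 7%N.
Local Notation rP := 8%N.
Local Notation rT := 9%N.

Local Notation vN := (IVar 0).
Local Notation vK := (IVar 1).
Local Notation vJ := (IVar rJ).
Local Notation vL := (IVar rL).
Local Notation vC := (IVar rC).
Local Notation vI := (IVar rI).
Local Notation vM := (IVar rM).
Local Notation vF := (IVar rF).
Local Notation vP := (IVar rP).
Local Notation vT := (IVar rT).
Local Notation v2K := (IAdd vK vK).
Local Notation "0" := (ILit 0) : iexp_scope.
Local Notation "1" := (ILit 1) : iexp_scope.
Local Notation "2" := (ILit 2) : iexp_scope.

Local Notation aD := 0%N.
Local Notation aU := 1%N.
Local Notation aV := 2%N.
Local Notation aH := 3%N.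
Local Notation aX := 4%N.
Local Notation aQ := 5%N.
Local Notation aR := 6%N.
Local Notation aF := 7%N.
Local Notation aW := 8%N.
Local Notation aE := 9%N.
Local Notation aS := 10%N.
Local Notation aB := 11%N.

Definition gather : cmd :=
  For rL vN (For rC vK
    (Seq (CSet aX vL vC (CCell aU vL vC))
         (CSet aX vL (vK + vC) (CCell aV vL vC)))).

(** The answer [n] in [rM] stands for failure. *)
Definition find_pivot : cmd :=
  Seq (ISet rM vN)
      (For rP vN
        (CIf CEq (CCell aB vP vC) CZero Skip
          (CIf CEq (CCell aD vP 0) (CCell aD vI 0) (ISet rM vP) Skip))).

Definition rotate : cmd :=
  let a := CCell aS 0 0 in
  let b := CCell aS 1 0 in
  let r := CCell aS 2 0 in
  let t := CCell aS (ILit 3) 0 in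
  Seq (CSet aS 0 0 (CCell aX vM vC))
  (Seq (CSet aS 1 0 (CCell aX vI vC))
  (Seq (CSet aS 2 0 (CUn USqrt (a * conj a + b * conj b)))
  (Seq (CSet aS 0 0 (a / r))
  (Seq (CSet aS 1 0 (b / r))
       (For rP v2K
         (Seq (CSet aS (ILit 3) 0 (CCell aX vM vP))
         (Seq (CSet aX vM vP (conj a * t + conj b * CCell aX vI vP))
              (CSet aX vI vP (a * CCell aX vI vP - b * t))))))))).

Definition reduce_entry : cmd :=
  IIf vF 0
    (Seq find_pivot
         (IIf vN vM
           (CIf CEq (CCell aX vI vC) CZero Skip
             (Seq (CSet aB vI vC COne) (ISet rF 1)))
           rotate))
    Skip.

Definition deflate : cmd :=
  For rI vN (Seq (ISet rF 0) (For rC v2K reduce_entry)).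

Definition init_residuals : cmd :=
  For rC v2K (fill_loop aR rL vN vC (CCell aX vL vC)).

Local Notation vQ := (CCell aQ vL (vJ + 1)).

Definition square_norm : cmd :=
  sum_loop aS 0 0 rL vN (CCell aE vL 0 * conj (CCell aE vL 0)).

Definition normalize : cmd :=
  fill_loop aQ rL vN (vJ + 1) (CCell aE vL 0 / CUn USqrt (CCell aS 0 0)).

Definition new_coefs : cmd :=
  For rC v2K (sum_loop aF vC vJ rL vN (conj vQ * CCell aX vL vC)).

Definition update_residuals : cmd :=
  For rC v2K (fill_loop aR rL vN vC (CCell aR vL vC - vQ * CCell aF vC vJ)).

Definition apply_diag : cmd := fill_loop aW rL vN 0 (CCell aD vL 0 * vQ).

Definition add_low_rank : cmd :=
  For rC vK (fill_loop aW rL vN 0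
    (CCell aW vL 0 + (CCell aR vL vC * conj (CCell aF (vK + vC) vJ)
     + (CCell aX vL (vK + vC) - CCell aR vL (vK + vC)) * conj (CCell aF vC vJ)))).

Definition last_coef : cmd := sum_loop aS 1 0 rL vN (conj vQ * CCell aW vL 0).

Definition previous_coef : cmd :=
  sum_loop aS 2 0 rL vN (conj (CCell aQ vL vJ) * CCell aW vL 0).

Definition next_residual : cmd :=
  fill_loop aR rL vN v2K
    (CCell aW vL 0 - vQ * CCell aS 1 0 - CCell aQ vL vJ * CCell aS 2 0).

Definition append : cmd :=
  Seq square_norm (Seq normalize (Seq new_coefs (Seq update_residuals
  (Seq apply_diag (Seq add_low_rank (Seq last_coef (Seq previous_coef
  (Seq next_residual (ISet rJ (vJ + 1)))))))))).

Definition test_zero_row : cmd :=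
  Seq (ISet rF 0)
      (For rC v2K (CIf CEq (CCell aX vI vC) CZero Skip (ISet rF 1))).

Definition load_unit_vector : cmd :=
  Seq (fill_loop aE rL vN 0 CZero) (CSet aE vI 0 COne).

Definition append_zero_rows : cmd :=
  For rI vN
    (Seq test_zero_row (IIf vF 0 (Seq load_unit_vector append) Skip)).

(** The last nonzero column is kept, so that the image of the last vector, in
    column 2k, has priority over the columns of [U] and [V]. *)
Definition find_nonzero_residual : cmd :=
  For rC (v2K + 1)
    (For rL vN (CIf CEq (CCell aR vL vC) CZero Skip (ISet rM vC))).

Definition load_residual : cmd := fill_loop aE rL vN 0 (CCell aR vL vM).

Definition select : cmd := Seq find_nonzero_residual load_residual.

Definition extend : cmd := For rT (vN - vJ) (Seq select append).

Definition write_far_entries : cmd :=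
  For rI vN
    (IIf (vT + 2) vI
      (CSet aH vI vT CZero)
      (sum_loop aH vI vT rC vK
        (CCell aF vC vI * conj (CCell aF (vK + vC) vT)
         - CCell aF (vK + vC) vI * conj (CCell aF vC vT)))).

Definition apply_matrix : cmd :=
  Seq (fill_loop aW rL vN 0 (CCell aD vL 0 * CCell aQ vL (vT + 1)))
      (For rC vK (fill_loop aW rL vN 0
        (CCell aW vL 0 + CCell aX vL vC * conj (CCell aF (vK + vC) vT)))).

Definition write_entry (i : iexp) : cmd :=
  sum_loop aH i vT rL vN (conj (CCell aQ vL (i + 1)) * CCell aW vL 0).

(** The three entries next to the diagonal are written last. In the first
    column, truncated subtraction makes the first of them the diagonal entry;
    in the last column, the third one falls outside the output. *)
Definition write_column : cmd :=
  Seq write_far_entries (Seq apply_matrix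
  (Seq (write_entry (vT - 1)%ix)
  (Seq (write_entry vT) (write_entry (vT + 1)%ix)))).

Definition write_output : cmd := For rT vN write_column.

Definition hessenberg_reduction : cmd :=
  Seq gather (Seq deflate (Seq init_residuals
    (Seq append_zero_rows (Seq extend write_output)))).

(** The constant is a generous bound for the sum of the coefficients of the
    cost, as a polynomial in [n] and [k]. *)
Lemma hessenberg_reduction_cost (C : numClosedFieldType) (s : state C) n k :
    ireg s 0 = n -> ireg s 1 = k -> (0 < k)%N -> (k <= n)%N ->
  (ops (exec hessenberg_reduction s) <= ops s + 1000 * (n ^ 2 * k))%N.
Proof.
move=> rn rk k_gt0 le_kn; apply: leq_trans (exec_cost _ _) _ => //.
rewrite leq_add2l rn rk.
have n_gt0 := leq_trans k_gt0 le_kn.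
(* every monomial of the cost is at most n * n * k *)
have nnk : (n * n <= n * n * k)%N by rewrite leq_pmulr.
have nkk : (n * k * k <= n * n * k)%N by rewrite leq_mul2r leq_mul2l le_kn !orbT.
have nk : (n * k <= n * n * k)%N by rewrite leq_mul2r leq_pmull ?orbT.
have n1 : (n <= n * k)%N by rewrite leq_pmulr.
have k1 : (k <= n * k)%N by rewrite leq_pmull.
rewrite expnS expn1 /=; lia.
Qed.

(** * Extending the basis by one vector *)

Section Append.
Variables (C : numClosedFieldType) (n k : nat).
Implicit Types s : state C.

Lemma exec_new_coefs s j : ireg s 0 = n -> ireg s 1 = k -> ireg s rJ = j ->
  forall a i i', cell (exec new_coefs s) a i i' =
    if [&& a == aF, (i < k + k)%N & i' == j]
    then \sum_(l < n) (cell s aQ l j.+1)^* * cell s aX l i else cell s a i i'.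
Proof.
move=> rn rk rj.
pose P v s' := [/\ ireg s' 0 = n, ireg s' rJ = j & forall a i i',
  cell s' a i i' = if [&& a == aF, (i < v)%N & i' == j]
    then \sum_(l < n) (cell s aQ l j.+1)^* * cell s aX l i else cell s a i i'].
suff [] : P (k + k)%N (exec new_coefs s) by [].
have <- : ieval (ireg s) v2K = (k + k)%N by rewrite /= rk.
apply: for_ind; first by split=> // a i i'; rewrite ltn0 andbF.
move=> c s' _ [rn' rj' cs']; split; try by rewrite exec_reg.
move=> a i i'.
rewrite (exec_sum_loop (f := fun l => (cell s aQ l j.+1)^* * cell s aX l c)
  (I := c) (J := j) (m := n)) //=.
- rewrite cs' [in RHS]ltnS (leq_eqVlt i c); have [->|_] := eqVneq i c; last by rewrite andbF.
  by rewrite ltnn andbF /=; case: ifP.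
- by move=> s2 rs; rewrite !rs //= ?rj'.
move=> l s2 _ rs cs; rewrite !rs /= rj' !cs ?cs' //= ?addn1 //.
Qed.

Lemma exec_update_residuals s j :
    ireg s 0 = n -> ireg s 1 = k -> ireg s rJ = j ->
  forall a i i', cell (exec update_residuals s) a i i' =
    if [&& a == aR, (i < n)%N & (i' < k + k)%N]
    then cell s aR i i' - cell s aQ i j.+1 * cell s aF i' j else cell s a i i'.
Proof.
move=> rn rk rj.
pose P v s' := [/\ ireg s' 0 = n, ireg s' rJ = j & forall a i i',
  cell s' a i i' = if [&& a == aR, (i < n)%N & (i' < v)%N]
    then cell s aR i i' - cell s aQ i j.+1 * cell s aF i' j else cell s a i i'].
suff [] : P (k + k)%N (exec update_residuals s) by [].
have <- : ieval (ireg s) v2K = (k + k)%N by rewrite /= rk.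
apply: for_ind; first by split=> // a i i'; rewrite ltn0 !andbF.
move=> c s' _ [rn' rj' cs']; split; try by rewrite exec_reg.
move=> a i i'.
rewrite (exec_fill_loop (f := fun l => cell s aR l c - cell s aQ l j.+1 * cell s aF c j)
  (J := c) (m := n)) //=.
- rewrite cs' (ltnS i') (leq_eqVlt i'); have [->|_] := eqVneq i' c; last by rewrite !andbF.
  by rewrite ltnn !andbF /=; case: ifP.
- by move=> s2 rs; rewrite !rs.
move=> l s2 l_lt rs cs; rewrite !rs /= rj' !cs ?ltnn ?andbF // !cs' /= ?ltnn ?andbF //.
by rewrite addn1.
Qed.

Lemma exec_add_low_rank s j : ireg s 0 = n -> ireg s 1 = k -> ireg s rJ = j ->
  forall a i i', cell (exec add_low_rank s) a i i' =
    if [&& a == aW, (i < n)%N & i' == 0%N]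
    then cell s aW i 0 + \sum_(c < k)
      (cell s aR i c * (cell s aF (k + c) j)^*
       + (cell s aX i (k + c) - cell s aR i (k + c)) * (cell s aF c j)^*)
    else cell s a i i'.
Proof.
move=> rn rk rj.
pose P v s' := [/\ ireg s' 0 = n, ireg s' 1 = k, ireg s' rJ = j & forall a i i',
  cell s' a i i' = if [&& a == aW, (i < n)%N & i' == 0%N]
    then cell s aW i 0 + \sum_(c < v)
      (cell s aR i c * (cell s aF (k + c) j)^*
       + (cell s aX i (k + c) - cell s aR i (k + c)) * (cell s aF c j)^*)
    else cell s a i i'].
suff [] : P k (exec add_low_rank s) by [].
have <- : ieval (ireg s) vK = k by [].
apply: for_ind.
  split=> // a i i'; rewrite big_ord0 addr0.
  by case: ifP => // /and3P[/eqP -> _ /eqP ->].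
move=> c s' _ [rn' rk' rj' cs']; split; try by rewrite exec_reg.
move=> a i i'.
rewrite (exec_fill_loop (f := fun l => cell s aW l 0 + \sum_(c' < c.+1)
      (cell s aR l c' * (cell s aF (k + c') j)^*
       + (cell s aX l (k + c') - cell s aR l (k + c')) * (cell s aF c' j)^*))
  (J := 0%N) (m := n)) //=.
- by rewrite cs'; case: [&& _, _ & _].
move=> l s2 l_lt rs cs; rewrite !rs /= rj' rk' !cs ?ltnn ?andbF // !cs' /= l_lt /=.
by rewrite big_ord_recr /= !addrA.
Qed.

(** Here [q] is the new vector, [f] its inner products with the columns of
    [U V], [r] the updated residuals and [z] the vector from which
    [short_recurrence] obtains the residual of the image of [q]. *)
Lemma exec_append s j (d e : nat -> C) (x : nat -> nat -> C) :
    ireg s 0 = n -> ireg s 1 = k -> ireg s rJ = j ->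
    (forall l, cell s aD l 0 = d l) -> (forall l c, cell s aX l c = x l c) ->
    (forall l, cell s aE l 0 = e l) ->
  forall (q f z : nat -> C) (r : nat -> nat -> C) s',
    (forall l, q l = e l / sqrtC (\sum_(l < n) e l * (e l)^*)) ->
    (forall c, f c = \sum_(l < n) (q l)^* * x l c) ->
    (forall l c, r l c = cell s aR l c - q l * f c) ->
    (forall l, z l = d l * q l + \sum_(c < k) (r l c * (f (k + c)%N)^*
       + (x l (k + c)%N - r l (k + c)%N) * (f c)^*)) ->
    s' = exec append s ->
  [/\ ireg s' rJ = j.+1,
      forall l i, (l < n)%N ->
        cell s' aQ l i = if i == j.+1 then q l else cell s aQ l i,
      forall c i, (c < k + k)%N ->
        cell s' aF c i = if i == j then f c else cell s aF c i,
      forall l c, (l < n)%N -> (c < k + k)%N -> cell s' aR l c = r l c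
    & forall l, (l < n)%N -> cell s' aR l (k + k)%N =
        z l - q l * (\sum_(l < n) (q l)^* * z l)
            - cell s aQ l j * (\sum_(l < n) (cell s aQ l j)^* * z l)].
Proof.
move=> rn rk rj dE xE eE q f z r s' qE fE rE zE {s'}->.
have [s1 s1E] : {s' | s' = exec square_norm s} by eexists.
have cs1 a i i' : cell s1 a i i' = if [&& a == aS, i == 0%N & i' == 0%N]
    then \sum_(l < n) e l * (e l)^* else cell s a i i'.
  rewrite s1E; apply: (exec_sum_loop (f := fun l => e l * (e l)^*)) => // l s' _ rs cs /=.
  by rewrite !rs /= !cs // eE.
have rs1 y : y != rL -> ireg s1 y = ireg s y.
  by move=> yL; rewrite s1E exec_reg //= inE.
have nrm_ge0 : 0 <= \sum_(l < n) e l * (e l)^*.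
  by apply: sumr_ge0 => l _; rewrite mul_conjC_ge0.
have [s2 s2E] : {s' | s' = exec normalize s1} by eexists.
have cs2 a i i' : cell s2 a i i' = if [&& a == aQ, (i < n)%N & i' == j.+1]
    then q i else cell s1 a i i'.
  rewrite s2E; apply: (exec_fill_loop (f := q)).
  - by rewrite /= rs1.
  - by move=> s2' rs /=; rewrite rs //= rs1 // rj addn1.
  by move=> l s2' _ rs cs /=; rewrite !rs /= !cs // !cs1 /= eE nrm_ge0 qE.
have rs2 y : y != rL -> ireg s2 y = ireg s y.
  by move=> yL; rewrite s2E exec_reg ?rs1 //= inE.
have q2 l : (l < n)%N -> cell s2 aQ l j.+1 = q l.
  by move=> l_lt; rewrite cs2 l_lt /= eqxx.
have x2 l c : cell s2 aX l c = x l c by rewrite cs2 /= cs1 /= xE.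
have [s3 s3E] : {s' | s' = exec new_coefs s2} by eexists.
have cs3 a i i' : cell s3 a i i' = if [&& a == aF, (i < k + k)%N & i' == j]
    then f i else cell s2 a i i'.
  rewrite s3E (exec_new_coefs (j := j)) ?rs2 //; case: ifP => // _.
  by rewrite fE; apply: eq_bigr => l _; rewrite q2 // x2.
have rs3 y : y \notin [:: rL; rC] -> ireg s3 y = ireg s y.
  by rewrite !inE => yN; rewrite s3E exec_reg ?rs2 //= ?inE; lia.
have [s4 s4E] : {s' | s' = exec update_residuals s3} by eexists.
have cs4 a i i' : cell s4 a i i' = if [&& a == aR, (i < n)%N & (i' < k + k)%N]
    then r i i' else cell s3 a i i'.
  rewrite s4E (exec_update_residuals (j := j)) ?rs3 //.
  case: ifP => // /and3P[_ i_lt i'_lt].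
  by rewrite rE !cs3 /= i'_lt eqxx q2 // cs2 /= cs1.
have rs4 y : y \notin [:: rL; rC] -> ireg s4 y = ireg s y.
  by rewrite !inE => yN; rewrite s4E exec_reg ?rs3 //= ?inE; lia.
have q4 l : (l < n)%N -> cell s4 aQ l j.+1 = q l by move=> l_lt; rewrite cs4 cs3 /= q2.
have [s5 s5E] : {s' | s' = exec apply_diag s4} by eexists.
have cs5 a i i' : cell s5 a i i' = if [&& a == aW, (i < n)%N & i' == 0%N]
    then d i * q i else cell s4 a i i'.
  rewrite s5E; apply: (exec_fill_loop (f := fun l => d l * q l)) => //.
    by rewrite /= rs4.
  move=> l s2' l_lt rs cs /=; rewrite !rs /= !cs // rs4 // rj addn1 q4 //.
  by rewrite cs4 cs3 cs2 cs1 dE.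
have rs5 y : y \notin [:: rL; rC] -> ireg s5 y = ireg s y.
  by rewrite !inE => yN; rewrite s5E exec_reg ?rs4 //= ?inE; lia.
have [s6 s6E] : {s' | s' = exec add_low_rank s5} by eexists.
have cs6 a i i' : cell s6 a i i' = if [&& a == aW, (i < n)%N & i' == 0%N]
    then z i else cell s4 a i i'.
  rewrite s6E (exec_add_low_rank (j := j)) ?rs5 // !cs5.
  case: ifP => [/and3P[_ i_lt _]|-> //].
  rewrite /= i_lt /= zE; congr (_ + _); apply: eq_bigr => c _.
  have c_lt : (c < k + k)%N by rewrite ltn_addr.
  have kc_lt : (k + c < k + k)%N by rewrite ltn_add2l.
  rewrite !cs5 !cs4 /= i_lt c_lt kc_lt /= !cs3 /= c_lt kc_lt eqxx /=.
  by rewrite x2.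
have rs6 y : y \notin [:: rL; rC] -> ireg s6 y = ireg s y.
  by rewrite !inE => yN; rewrite s6E exec_reg ?rs5 //= ?inE; lia.
have Q6 l i : (l < n)%N ->
    cell s6 aQ l i = if i == j.+1 then q l else cell s aQ l i.
  by move=> l_lt; rewrite cs6 /= cs4 /= cs3 /= cs2 /= l_lt /= cs1.
have z6 l : (l < n)%N -> cell s6 aW l 0 = z l.
  by move=> l_lt; rewrite cs6 /= l_lt.
have [s7 s7E] : {s' | s' = exec last_coef s6} by eexists.
have cs7 a i i' : cell s7 a i i' = if [&& a == aS, i == 1%N & i' == 0%N]
    then \sum_(l < n) (q l)^* * z l else cell s6 a i i'.
  rewrite s7E; apply: (exec_sum_loop (f := fun l => (q l)^* * z l)) => //.
    by rewrite /= rs6.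
  move=> l s2' l_lt rs cs /=; rewrite !rs /= !cs // rs6 // rj addn1 Q6 // eqxx.
  by rewrite z6.
have rs7 y : y \notin [:: rL; rC] -> ireg s7 y = ireg s y.
  by rewrite !inE => yN; rewrite s7E exec_reg ?rs6 //= ?inE; lia.
have [s8 s8E] : {s' | s' = exec previous_coef s7} by eexists.
have Qj l : (l < n)%N -> cell s6 aQ l j = cell s aQ l j.
  by move=> l_lt; rewrite Q6 // (_ : (j == j.+1) = false) //; lia.
have cs8 a i i' : cell s8 a i i' = if [&& a == aS, i == 2%N & i' == 0%N]
    then \sum_(l < n) (cell s aQ l j)^* * z l else cell s7 a i i'.
  rewrite s8E; apply: (exec_sum_loop (f := fun l => (cell s aQ l j)^* * z l)) => //.
    by rewrite /= rs7.
  move=> l s2' l_lt rs cs /=; rewrite !rs /= !cs // !cs7 /= rs7 // rj Qj //.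
  by rewrite z6.
have rs8 y : y \notin [:: rL; rC] -> ireg s8 y = ireg s y.
  by rewrite !inE => yN; rewrite s8E exec_reg ?rs7 //= ?inE; lia.
pose w l := z l - q l * (\sum_(l < n) (q l)^* * z l)
            - cell s aQ l j * (\sum_(l < n) (cell s aQ l j)^* * z l).
have [s9 s9E] : {s' | s' = exec next_residual s8} by eexists.
have cs9 a i i' : cell s9 a i i' = if [&& a == aR, (i < n)%N & i' == (k + k)%N]
    then w i else cell s8 a i i'.
  rewrite s9E; apply: (exec_fill_loop (f := w)) => //.
  - by rewrite /= rs8.
  - by move=> s2' rs /=; rewrite !rs // rs8 // rk.
  move=> l s2' l_lt rs cs /=; rewrite !rs /= !cs // rs8 // rj addn1.
  by rewrite !cs8 /= !cs7 /= z6 // Q6 // eqxx Qj.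
have rs9 y : y \notin [:: rL; rC] -> ireg s9 y = ireg s y.
  by rewrite !inE => yN; rewrite s9E exec_reg ?rs8 //= ?inE; lia.
have -> : exec append s = set_ireg s9 rJ (ireg s9 rJ + 1).
  by rewrite s9E s8E s7E s6E s5E s4E s3E s2E s1E.
rewrite /=; split.
- by rewrite rs9 // rj addn1.
- by move=> l i l_lt; rewrite cs9 /= cs8 /= cs7 /= Q6.
- move=> c i c_lt; rewrite cs9 /= cs8 /= cs7 /= cs6 /= cs4 /= cs3 /= c_lt /=.
  by rewrite cs2 cs1.
- move=> l c l_lt c_lt; rewrite cs9 /= ltn_eqF // andbF cs8 /= cs7 /= cs6 /= cs4.
  by rewrite l_lt c_lt.
by move=> l l_lt; rewrite cs9 l_lt !eqxx.
Qed.

End Append.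

(** * The short recurrence *)

Section Arnoldi.
Variables (C : numClosedFieldType) (n k : nat).
Implicit Types s : state C.
Variables (d : nat -> C) (x : nat -> nat -> C).
Hypothesis d_real : forall l, (d l)^* = d l.

Definition vec s a c : 'cV[C]_n := \col_(l < n) cell s a l c.

Let xcol c : 'cV[C]_n := \col_(l < n) x l c.
Let D : 'M[C]_n := diag_mx (\row_(l < n) d l).
Let U : 'M[C]_(n, k) := \matrix_(l < n, c < k) x l c.
Let V : 'M[C]_(n, k) := \matrix_(l < n, c < k) x l (k + c)%N.
Let A : 'M[C]_n := D + U *m V^t*.

(** The invariant of the iteration when [j] vectors are known; for [j = 0] the
    vector [v j] is 0, and so is its residual. *)
Definition arnoldi s j : Prop :=
  let v := vec s aQ in
  let P := proj v j in
  [/\ [/\ ireg s 0 = n, ireg s 1 = k & ireg s rJ = j],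
      (forall l, cell s aD l 0 = d l) /\ (forall l c, cell s aX l c = x l c),
      hess_basis A v j,
      (forall c, (c < k + k)%N -> vec s aR c = xcol c - P *m xcol c) /\
        vec s aR (k + k) = A *m v j - P *m (A *m v j)
    & forall c i, (c < k + k)%N -> (i < j)%N ->
        cell s aF c i = ((v i.+1)^t* *m xcol c) 0 0].

Lemma diag_herm : D^t* = D.
Proof.
by rewrite tr_diag_mx map_diag_mx; congr diag_mx; apply/rowP=> l; rewrite !mxE; apply: d_real.
Qed.

Lemma mul_xcol m (u : 'M_(m, n)) (M : 'M_(n, k)) i c c' :
  (forall l : 'I_n, M l c = x l c') -> (u *m M) i c = (u *m xcol c') i 0.
Proof. by move=> ME; rewrite !mxE; apply: eq_bigr => l _; rewrite mxE ME. Qed.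

Lemma adj_mul_xcol (u : 'cV_n) (M : 'M_(n, k)) c c' :
  (forall l : 'I_n, M l c = x l c') ->
  (M^t* *m u) c 0 = ((u^t* *m xcol c') 0 0)^*.
Proof.
move=> ME; rewrite !mxE rmorph_sum; apply: eq_bigr => l _.
by rewrite !mxE ME rmorphM /= conjCK mulrC.
Qed.

(** Any direction orthogonal to the basis may be appended, provided that the
    residual of the last image is a multiple of it, for instance 0. That the
    program computes the next residual is [short_recurrence]. *)
Lemma arnoldi_append s s' j :
    s' = exec append s -> arnoldi s j -> vec s aE 0 != 0 ->
    proj (vec s aQ) j *m vec s aE 0 = 0 ->
    (exists b, vec s aR (k + k) = b *: vec s aE 0) ->
  [/\ arnoldi s' j.+1, forall i, (i <= j)%N -> vec s' aQ i = vec s aQ i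
    & exists2 a, a != 0 & vec s' aQ j.+1 = a *: vec s aE 0].
Proof.
move=> s'E [[rn rk rj] [dE xE] basis [resX resA] coefF].
set e := vec s aE 0 => e_neq0 Pe0 [b resE].
have [nrm nrmE] : {nrm | nrm = \sum_(l < n) cell s aE l 0 * (cell s aE l 0)^*}.
  by eexists.
have [q qE] : {q | forall l, q l = cell s aE l 0 / sqrtC nrm} by eexists.
have [f fcE] : {f | forall c, f c = \sum_(l < n) (q l)^* * x l c} by eexists.
have [r rcE] : {r | forall l c, r l c = cell s aR l c - q l * f c} by eexists.
have [z zlE] : {z | forall l, z l = d l * q l + \sum_(c < k) (r l c * (f (k + c)%N)^*
    + (x l (k + c)%N - r l (k + c)%N) * (f c)^*)} by eexists.
have [|rj' Q' F' R' W'] := exec_append rn rk rj dE xE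
  (e := fun l => cell s aE l 0) (fun=> erefl) _ fcE rcE zlE s'E; first by rewrite -nrmE.
have rs' y : (y < 2)%N -> ireg s' y = ireg s y.
  by move=> y_lt; rewrite s'E exec_reg //= ?inE; lia.
have cs' a l c : (a == aD) || (a == aX) -> cell s' a l c = cell s a l c.
  by move=> aP; rewrite s'E exec_array //= ?inE; lia.
have nrm_gt0 : 0 < nrm.
  rewrite nrmE lt_neqAle sumr_ge0 => [|l _]; last by rewrite mul_conjC_ge0.
  rewrite andbT eq_sym; apply: contra e_neq0 => nrm0; apply/eqP/colP => l.
  move: nrm0; rewrite psumr_eq0 => [/allP /(_ l)|i _]; last by rewrite mul_conjC_ge0.
  by rewrite mem_index_enum mul_conjC_eq0 => /(_ isT) /eqP; rewrite !mxE.
have sq_gt0 : 0 < sqrtC nrm by rewrite sqrtC_gt0.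
set a := (sqrtC nrm)^-1; have a_neq0 : a != 0 by rewrite invr_eq0 gt_eqF.
set v' := vec s' aQ; set v := vec s aQ.
have vj : v' j.+1 = a *: e.
  by apply/colP=> l; rewrite !mxE Q' // eqxx qE mulrC.
have eqv i : (i <= j)%N -> v i = v' i.
  by move=> i_le; apply/colP=> l; rewrite !mxE Q' // ltn_eqF.
have q1 : (v' j.+1)^t* *m v' j.+1 = 1%:M.
  rewrite [LHS]mx11_scalar; congr _%:M; rewrite vj mxE.
  rewrite (eq_bigr (fun l : 'I_n => a ^+ 2 * (cell s aE l 0 * (cell s aE l 0)^*))).
    by rewrite -mulr_sumr -nrmE exprVn sqrtCK mulVf ?gt_eqF.
  move=> l _; rewrite !mxE rmorphM /= [a^*]conj_Creal; first by ring.
  by rewrite realV gtr0_real.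
have eqP' i : (i <= j)%N -> proj v i = proj v' i.
  by move=> i_le; apply: eq_proj => l l_le; apply/eqv/(leq_trans l_le).
have basis' : hess_basis A v' j.+1.
  apply: hess_basisS => //; first exact: eq_hess_basis basis.
    by rewrite -eqP' // vj -scalemxAr Pe0 scaler0.
  exists (b / a); rewrite -eqP' // -eqv // -resA resE vj scalerA.
  by rewrite divfK.
have fE c : f c = ((v' j.+1)^t* *m xcol c) 0 0.
  rewrite fcE mxE; apply: eq_bigr => l _.
  by rewrite !mxE Q' // eqxx.
have rE l c : (c < k + k)%N -> r (val l) c = (xcol c - proj v' j.+1 *m xcol c) l 0.
  move=> c_lt; rewrite projS -eqP' // mulmxDl opprD addrA -resX //.
  rewrite -mulmxA [(v' _)^t* *m _]mx11_scalar -fE mul_mx_scalar !mxE rcE.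
  by rewrite Q' // eqxx mulrC.
have zE : \col_(l < n) z l = D *m v' j.+1
    + (U - proj v' j.+1 *m U) *m (V^t* *m v' j.+1)
    + proj v' j.+1 *m V *m (U^t* *m v' j.+1).
  apply/colP=> l; rewrite mxE zlE [in RHS]mxE [X in _ = X + _]mxE mul_diag_mx -addrA.
  congr (_ + _); first by rewrite !mxE Q' // eqxx.
  rewrite [X in _ = X + _]mxE [X in _ = _ + X]mxE -big_split /=.
  apply: eq_bigr => c _.
  have c_lt : (c < k + k)%N by rewrite ltn_addr.
  have kc_lt : (k + c < k + k)%N by rewrite ltn_add2l.
  have UE m : U m c = x m c by rewrite mxE.
  have VE m : V m c = x m (k + c)%N by rewrite mxE.
  rewrite (adj_mul_xcol _ UE) (adj_mul_xcol _ VE) -!fE !rE // (mul_xcol _ _ VE).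
  rewrite [in RHS]mxE [(- _ : 'M_(n, k)) l c]mxE (mul_xcol _ _ UE).
  by congr (_ * _ + _ * _); [rewrite !mxE | rewrite !mxE subKr].
split; first split.
- by split; [rewrite rs'|rewrite rs'|].
- by split=> *; rewrite cs'.
- exact: basis'.
- split=> [c c_lt|]; first by apply/colP=> l; rewrite -rE // mxE R'.
  rewrite -short_recurrence ?diag_herm // -zE.
  apply/colP=> l; rewrite mxE W' // !mxE !big_ord1 !mxE Q' // eqxx.
  rewrite (Q' l j) // ltn_eqF //.
  by congr (_ - _ * _ - _ * _); apply: eq_bigr => m _; rewrite !mxE Q' // ?eqxx // ltn_eqF.
- move=> c i c_lt; rewrite ltnS leq_eqVlt F' // => /predU1P[->|i_lt].
    by rewrite eqxx fE.
  by rewrite ltn_eqF // coefF // -/v eqv.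
- by move=> i /eqv.
by exists a.
Qed.

(** * Completing the basis *)

Lemma eq_arnoldi s s' j :
    (forall y, (y < 3)%N -> ireg s' y = ireg s y) ->
    (forall a i i', a \in [:: aD; aX; aQ; aR; aF] ->
       cell s' a i i' = cell s a i i') ->
  arnoldi s j -> arnoldi s' j.
Proof.
move=> rs cs [[rn rk rj] [dE xE] basis [resX resA] coefF].
have vE a c : a \in [:: aD; aX; aQ; aR; aF] -> vec s' a c = vec s a c.
  by move=> aP; apply/colP=> l; rewrite !mxE cs.
have pE i : proj (vec s' aQ) i = proj (vec s aQ) i.
  by apply: eq_proj => l _; rewrite vE.
split.
- by rewrite !rs.
- by split=> *; rewrite cs.
- by apply: eq_hess_basis basis => i _; rewrite vE.
- by rewrite pE !vE //; split=> // c c_lt; rewrite vE ?resX.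
by move=> c i c_lt i_lt; rewrite cs // vE ?coefF.
Qed.

Definition zero_row (l : nat) : Prop := forall c, (c < k + k)%N -> x l c = 0.

Definition spans_zero_row s j (i : 'I_n) : Prop :=
  zero_row i -> proj (vec s aQ) j *m delta_mx i 0 = delta_mx i 0 :> 'cV_n.

Lemma spans_zero_row_append s s' j (e : 'cV[C]_n) a i :
    (forall i, (i <= j)%N -> vec s' aQ i = vec s aQ i) ->
    vec s' aQ j.+1 = a *: e -> proj (vec s aQ) j *m e = 0 ->
  spans_zero_row s j i -> spans_zero_row s' j.+1 i.
Proof.
move=> eqv qE Pe0 iP xi0; rewrite projS mulmxDl.
rewrite (eq_proj (v' := vec s aQ)) // iP // -mulmxA -[X in _ + _ *m (_ *m X)]iP //.
rewrite [(_)^t* *m (_ *m _)]mulmxA adj_mul_proj0 ?mul0mx ?mulmx0 ?addr0 //.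
by rewrite qE -scalemxAr Pe0 scaler0.
Qed.

Lemma exec_test_zero_row s :
    ireg s 1 = k -> (forall l c, cell s aX l c = x l c) ->
  ireg (exec test_zero_row s) rF = 0%N <-> zero_row (ireg s rI).
Proof.
move=> rk xE.
pose Z c s' := [/\ ireg s' rI = ireg s rI, forall l c, cell s' aX l c = x l c
  & ireg s' rF = 0%N <-> forall c', (c' < c)%N -> x (ireg s rI) c' = 0].
set s1 := exec (ISet rF 0) s.
suff [] : Z (k + k)%N (exec test_zero_row s) by [].
have <- : ieval (ireg s1) v2K = (k + k)%N by rewrite /= rk.
rewrite /test_zero_row exec_seq -/s1; apply: for_ind; first by split.
move=> c s' c_lt [ri' xE' rF']; rewrite /= xE' ri'.
case: eqP => [xic0|xic_neq0]; split=> //=.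
  rewrite rF'; split=> x0 c' c'_lt; last by apply: x0; rewrite ltnS ltnW.
  by move: c'_lt; rewrite ltnS leq_eqVlt => /predU1P[->|/x0].
by split=> // /(_ c (ltnSn c)).
Qed.

Lemma exec_load_unit_vector s (i : 'I_n) : ireg s 0 = n -> ireg s rI = i ->
  vec (exec load_unit_vector s) aE 0 = delta_mx i 0.
Proof.
move=> rn ri; rewrite /load_unit_vector exec_seq.
have [s1 s1E] : {s1 | s1 = exec (fill_loop aE rL vN 0 CZero) s} by eexists.
have ri1 : ireg s1 rI = i by rewrite s1E exec_reg.
rewrite -s1E; apply/colP=> l; rewrite !mxE /= ri1 !andbT.
rewrite val_eqE; case: eqP => // _.
by rewrite s1E (exec_fill_loop (f := fun=> 0) (J := 0%N) (m := n)) ?ltn_ord.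
Qed.

(** The unit vector of a zero row is an eigenvector, hence its image leaves no
    residual and the next unit vector may follow. *)
Lemma exec_append_zero_rows s : arnoldi s 0 ->
  exists j, [/\ (j <= n)%N, arnoldi (exec append_zero_rows s) j
    & forall i, spans_zero_row (exec append_zero_rows s) j i].
Proof.
move=> s0P.
have [[rn rk _] _ _ _ _] := s0P.
pose P i s' := exists j, [/\ (j <= i)%N, arnoldi s' j, vec s' aR (k + k) = 0,
  forall l : 'I_n, (l < i)%N -> spans_zero_row s' j l
  & forall l : 'I_n, (i <= l)%N -> proj (vec s' aQ) j *m delta_mx l 0 = 0 :> 'cV_n].
suff: P n (exec append_zero_rows s).
  by case=> j [j_le sP _ spanP _]; exists j; split=> // i; apply: spanP.
have <- : ieval (ireg s) vN = n by [].
apply: for_ind.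
  exists 0%N; split=> // [|l _]; last by rewrite /proj big_ord0 mul0mx.
  case: s0P => _ _ [v0 _ _] [_ ->] _.
  by rewrite v0 !mulmx0 subrr.
rewrite [ieval _ _]rn => i s1 i_lt [j [j_le s1P res0 spanP orthP]].
have [[rn1 rk1 rj1] [dE xE] _ _ _] := s1P.
rewrite exec_seq.
have [s2 s2E] : {s2 | s2 = exec test_zero_row (set_ireg s1 rI i)} by eexists.
have zeroP : ireg s2 rF = 0%N <-> zero_row i.
  by rewrite s2E; apply: exec_test_zero_row.
rewrite -s2E.
have rs2 y : y \notin [:: rC; rF; rI] -> ireg s2 y = ireg s1 y.
  by rewrite !inE => yN; rewrite s2E exec_reg /= ?inE ?ifN //; lia.
have cs2 a l c : cell s2 a l c = cell s1 a l c by rewrite s2E exec_array.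
have v2 c a : vec s2 a c = vec s1 a c by apply/colP=> l; rewrite !mxE cs2.
have p2 m : proj (vec s2 aQ) m = proj (vec s1 aQ) m.
  by apply: eq_proj => l _; rewrite v2.
have s2P : arnoldi s2 j.
  by apply: eq_arnoldi s1P => // y y_lt; rewrite rs2 // !inE; lia.
rewrite exec_iif [ieval _ vF]/= [ieval _ (ILit 0)]/= leqn0.
case: eqP => [/zeroP xi0|/eqP xi_neq0]; last first.
  exists j; split=> //; first exact: leqW; first by rewrite v2.
  - move=> l; rewrite ltnS leq_eqVlt => /predU1P[li xl0|l_lt].
      by case/eqP: xi_neq0; apply/zeroP; rewrite -li.
    by move=> xl0; rewrite p2 spanP.
  by move=> l i_lt_l; rewrite p2 orthP // ltnW.
pose io := Ordinal i_lt.
have ri2 : ireg s2 rI = io by rewrite s2E exec_reg.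
have [s3 s3E] : {s3 | s3 = exec load_unit_vector s2} by eexists.
have e3 : vec s3 aE 0 = delta_mx io 0.
  by rewrite s3E (exec_load_unit_vector (i := io)) // rs2.
rewrite exec_seq -s3E.
have cs3 a l c : a != aE -> cell s3 a l c = cell s1 a l c.
  by move=> aP; rewrite s3E exec_array ?cs2 //= !inE; lia.
have v3 c a : a != aE -> vec s3 a c = vec s1 a c.
  by move=> aP; apply/colP=> l; rewrite !mxE cs3.
have p3 m : proj (vec s3 aQ) m = proj (vec s1 aQ) m.
  by apply: eq_proj => l _; rewrite v3.
have s3P : arnoldi s3 j.
  apply: eq_arnoldi s2P => [y y_lt|a l c aP].
    by rewrite s3E exec_reg //= ?inE; lia.
  by rewrite cs3 ?cs2 //; apply: contraTneq aP => ->.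
have [s4 s4E] : {s4 | s4 = exec append s3} by eexists.
have Pe0 : proj (vec s3 aQ) j *m vec s3 aE 0 = 0 by rewrite e3 p3 orthP.
have [||s4P v4 [a a_neq0 q4]] := arnoldi_append s4E s3P _ Pe0.
- rewrite e3; apply/eqP=> /matrixP/(_ io 0)/eqP.
  by rewrite !mxE !eqxx oner_eq0.
- by exists 0; rewrite v3 // res0 scale0r.
have p4 m : (m <= j)%N -> proj (vec s4 aQ) m = proj (vec s1 aQ) m.
  by move=> m_le; rewrite -p3; apply: eq_proj => l l_le; apply/v4/(leq_trans l_le).
have [_ _ basis4 [_ res4] _] := s4P.
have Pe : proj (vec s4 aQ) j.+1 *m delta_mx io 0 = delta_mx io 0 :> 'cV_n.
  have := proj_id basis4 (leqnn _); rewrite q4 e3 -scalemxAr.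
  by move/(scalerI a_neq0).
rewrite -s4E; exists j.+1; split=> //.
- (* a zero row makes the unit vector an eigenvector *)
  have Ae : A *m delta_mx io 0 = d i *: delta_mx io 0 :> 'cV_n.
    rewrite mulmxDl -[_ *m _ *m delta_mx io 0]mulmxA.
    rewrite (_ : V^t* *m _ = 0) ?mulmx0 ?addr0.
      apply/colP=> l; rewrite mul_diag_mx !mxE !andbT.
      by case: eqP => [->|_] //; rewrite !mulr0.
    apply/colP=> c; rewrite !mxE big1 // => m _; rewrite !mxE andbT.
    case: eqP => [->|_]; last by rewrite mulr0.
    by rewrite xi0 ?ltn_add2l // rmorph0 mul0r.
  by rewrite res4 q4 e3 -!scalemxAr Ae -!scalemxAr Pe subrr.
- move=> l; rewrite ltnS leq_eqVlt => /predU1P[li _|l_lt].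
    by rewrite (_ : l = io) //; apply: val_inj.
  apply: (spans_zero_row_append v4 q4 Pe0) => // xl0.
  by rewrite p3 spanP.
move=> l i_lt_l; rewrite projS mulmxDl p4 // orthP ?(ltnW i_lt_l) // add0r.
rewrite q4 e3 -mulmxA (_ : _^t* *m _ = 0) ?mulmx0 //.
apply/matrixP=> u w; rewrite !mxE big1 // => m _; rewrite !mxE.
case: (m =P io) => [->|_]; last by rewrite mulr0 rmorph0 mul0r.
by rewrite (_ : (io == l) = false) ?mulr0 // -val_eqE /= ltn_eqF.
Qed.

(** The predicate [seen] of the invariant is the set of entries visited so
    far, in column-major order. *)
Lemma exec_find_nonzero_residual s :
    ireg s 0 = n -> ireg s 1 = k ->
    (exists2 c, (c <= k + k)%N & vec s aR c != 0) ->
  let m := ireg (exec find_nonzero_residual s) rM in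
  [/\ (m <= k + k)%N, vec s aR m != 0
    & forall c, (m < c <= k + k)%N -> vec s aR c = 0].
Proof.
move=> rn rk [c0 c0_le c0P].
pose Z (seen : nat -> nat -> bool) s' := [/\ ireg s' 0 = n, ireg s' 1 = k,
  forall l c, cell s' aR l c = cell s aR l c
  & let m := ireg s' rM in
    (forall l c, (l < n)%N -> seen l c -> cell s aR l c = 0) \/
    [/\ exists2 l, (l < n)%N & seen l m && (cell s aR l m != 0)
      & forall l c, (l < n)%N -> (m < c)%N -> seen l c -> cell s aR l c = 0]].
suff [_ _ _ [R0|[[l l_lt /andP[m_le Rm]] R0]]] :
    Z (fun _ c => (c < k + k + 1)%N) (exec find_nonzero_residual s).
- case/eqP: c0P; apply/colP=> l; rewrite !mxE R0 //.
  by rewrite addn1 ltnS.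
- split; first by move: m_le; rewrite addn1 ltnS.
    by apply: contraNneq Rm => /colP/(_ (Ordinal l_lt)); rewrite !mxE => ->.
  by move=> c /andP[mc c_le]; apply/colP=> l'; rewrite !mxE R0 // addn1 ltnS.
have <- : ieval (ireg s) (IAdd v2K (ILit 1)) = (k + k + 1)%N by rewrite /= rk.
apply: (for_ind (P := fun b => Z (fun _ c => (c < b)%N))).
  by split=> //; left.
move=> c s1 _ [rn1 rk1 cs1 s1P]; set s2 := set_ireg s1 rC c.
suff [] : Z (fun l c' => (c' < c)%N || (c' == c) && (l < n)%N)
  (exec (For rL vN (CIf CEq (CCell aR vL vC) CZero Skip (ISet rM vC))) s2) /\
  ireg (exec (For rL vN (CIf CEq (CCell aR vL vC) CZero Skip (ISet rM vC))) s2) rC = c.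
  move=> [rn2 rk2 cs2 s2P] _; split=> //=.
  case: s2P => [R0|[[l l_lt lP] R0]]; [left|right; split].
  - by move=> l c' l_lt; rewrite ltnS leq_eqVlt orbC => c'P; rewrite R0 // l_lt andbT.
  - exists l => //; move: lP; rewrite l_lt andbT => /andP[lP ->].
    by rewrite ltnS leq_eqVlt orbC lP.
  move=> l' c' l'_lt mc'; rewrite ltnS leq_eqVlt orbC => c'P.
  by rewrite R0 // l'_lt andbT.
have <- : ieval (ireg s2) vN = n by [].
apply: (for_ind (P := fun b s' =>
  Z (fun l c' => (c' < c)%N || (c' == c) && (l < b)%N) s' /\ ireg s' rC = c)).
  split=> //; split=> //=; case: s1P => [R0|[[l l_lt lP] R0]]; [left|right; split].
  - by move=> l c' l_lt; rewrite andbF orbF; apply: R0.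
  - by exists l; rewrite // andbF orbF.
  by move=> l' c' l'_lt mc'; rewrite andbF orbF; apply: R0.
rewrite [ieval _ _]rn1 => l s3 l_lt [[rn3 rk3 cs3 s3P] rc3]; rewrite /= rc3 cs3.
have seenS (l' c' : nat) : (c' < c)%N || (c' == c) && (l' < l.+1)%N ->
    (c' < c)%N || (c' == c) && (l' < l)%N \/ c' = c /\ l' = l.
  rewrite ltnS [(l' <= l)%N]leq_eqVlt; case: ltnP => //= _; first by left.
  by case: eqP => //= -> /predU1P[->|->]; [right|left].
case: eqP => [Rlc|/eqP Rlc]; split=> //=; split=> //=.
  case: s3P => [R0|[[l' l'_lt l'P] R0]]; [left|right; split].
  - by move=> l' c' l'_lt /seenS[|[-> ->]//]; apply: R0.
  - by exists l'; rewrite // ltnS; move: l'P; lia.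
  by move=> l'' c' l''_lt mc' /seenS[|[-> ->]//]; apply: R0.
right; split; first by exists l; rewrite // ltnn eqxx ltnSn Rlc.
by move=> l' c' _ cc'; lia.
Qed.

Lemma exec_select s (s' := exec select s) :
    ireg s 0 = n -> ireg s 1 = k ->
    (exists2 c, (c <= k + k)%N & vec s aR c != 0) ->
  exists m, [/\ (m <= k + k)%N, vec s aR m != 0, vec s' aE 0 = vec s aR m
    & forall c, (m < c <= k + k)%N -> vec s aR c = 0].
Proof.
move=> rn rk nzP; have [m_le mP cP] := exec_find_nonzero_residual rn rk nzP.
rewrite /s' /select exec_seq.
have [s1 s1E] : {s1 | s1 = exec find_nonzero_residual s} by eexists.
rewrite -!s1E in m_le mP cP *; exists (ireg s1 rM); split=> //.
apply/colP=> l; rewrite !mxE.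
rewrite (exec_fill_loop (f := fun l => cell s aR l (ireg s1 rM)) (J := 0%N) (m := n)) //.
- by rewrite ltn_ord.
- by rewrite /= s1E exec_reg.
move=> l' s2 l'_lt rs cs /=; rewrite !rs /= cs //.
by rewrite s1E exec_array.
Qed.

(** If nothing is left to append, the projection commutes with [D], fixes the
    columns of [U] and [V] and the unit vectors of the zero rows. Its complement
    is then 0 by [echelon_kernel]. *)
Lemma arnoldi_complete s j lead : echelon n (k + k) d x lead ->
    arnoldi s j -> (forall i, spans_zero_row s j i) ->
    (forall c, (c <= k + k)%N -> vec s aR c = 0) ->
  j = n.
Proof.
move=> ech [_ _ basis [resX resA] _] spanP R0.
set P := proj _ _ in resX resA.
have PX c : (c < k + k)%N -> P *m xcol c = xcol c.
  by move=> c_lt; apply/esym/eqP; rewrite -subr_eq0 -resX // R0 // ltnW.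
have PU : P *m U = U.
  apply/matrixP=> l c; have /PX/colP/(_ l) : (c < k + k)%N by rewrite ltn_addr.
  by rewrite !mxE => <-; apply: eq_bigr => m _; rewrite !mxE.
have PD : P *m D = D *m P.
  apply: (proj_comm diag_herm basis) => //.
  by apply/eqP; rewrite -subr_eq0 -resA R0.
apply: (proj1_size basis); apply/eqP; rewrite eq_sym -subr_eq0; apply/eqP.
apply: (echelon_kernel ech) => [l m dlm|l c c_lt|l m xm0].
- have /matrixP/(_ l m) : (1%:M - P) *m D = D *m (1%:M - P).
    by rewrite mulmxBl mulmxBr mul1mx mulmx1 PD.
  rewrite mul_mx_diag mul_diag_mx ![in X in X -> _]mxE mulrC => /eqP.
  rewrite -subr_eq0 -mulrBl mulf_eq0 subr_eq0 eq_sym (negPf dlm) /=.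
  by move/eqP=> <-; rewrite !mxE.
- have : ((1%:M - P) *m xcol c) l 0 = 0 by rewrite mulmxBl mul1mx PX // subrr mxE.
  rewrite mxE (eq_bigr (fun m : 'I_n => (1%:M - P) l m * x m c)) // => m _.
  by rewrite [xcol c m 0]mxE.
have : ((1%:M - P) *m (delta_mx m 0 : 'cV_n)) l 0 = 0.
  by rewrite mulmxBl mul1mx [P *m _]spanP // subrr mxE.
by rewrite -colE mxE.
Qed.

(** As long as the basis has fewer than [n] vectors, [arnoldi_complete] provides
    a nonzero residual: a multiple of the residual of the last image when that
    one is nonzero, else a new starting direction for an invariant span. *)
Lemma exec_extend s j lead : echelon n (k + k) d x lead ->
    (j <= n)%N -> arnoldi s j -> (forall i, spans_zero_row s j i) ->
  arnoldi (exec extend s) n.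
Proof.
move=> ech j_le sP spanP.
pose P t s' := arnoldi s' (j + t) /\ forall i, spans_zero_row s' (j + t) i.
suff [] : P (n - j)%N (exec extend s) by rewrite subnKC.
have [[rn _ rj] _ _ _ _] := sP.
have <- : ieval (ireg s) (ISub vN vJ) = (n - j)%N by rewrite /= rn rj.
apply: for_ind; first by rewrite /P addn0.
rewrite [ieval _ _]/= rn rj => t s1 t_lt [s1P span1].
have [s2 s2E] : {s2 | s2 = exec select (set_ireg s1 rT t)} by eexists.
have s2P : arnoldi s2 (j + t).
  apply: eq_arnoldi s1P => [y y_lt|a l c aP].
    by rewrite s2E exec_reg /= ?inE ?ifN //; lia.
  by rewrite s2E exec_array //; move: aP; rewrite !inE; lia.
have v2 a c : a != aE -> vec s2 a c = vec s1 a c.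
  by move=> aP; apply/colP=> l; rewrite !mxE s2E exec_array //= !inE; lia.
have span2 i : spans_zero_row s2 (j + t) i.
  by move=> xi0; rewrite (eq_proj (v' := vec s1 aQ)) ?span1 // => m _; rewrite v2.
have [[rn1 rk1 _] _ _ _ _] := s1P.
have [_ _ basis [resX resA] _] := s2P.
have nzP : exists2 c, (c <= k + k)%N & vec s1 aR c != 0.
  have [c cP|R0] := pickP (fun c : 'I_(k + k).+1 => vec s1 aR c != 0).
    by exists c; rewrite // -ltnS.
  have : (j + t)%N = n.
    apply: (arnoldi_complete ech s1P span1) => c c_le.
    by have /negbFE/eqP := R0 (Ordinal (c_le : (c < (k + k).+1)%N)).
  by move: t_lt; lia.
have [m [m_le Rm e2 R0]] := exec_select (s := set_ireg s1 rT t) rn1 rk1 nzP.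
have {}e2 : vec s2 aE 0 = vec s2 aR m by rewrite s2E e2 -s2E v2.
rewrite /P addnS exec_seq -s2E.
have Pe0 : proj (vec s2 aQ) (j + t) *m vec s2 aE 0 = 0.
  rewrite e2; move: m_le; rewrite leq_eqVlt => /predU1P[->|m_lt].
    by rewrite resA mulmxBr [X in _ - X]mulmxA (projK basis) // subrr.
  by rewrite resX // mulmxBr [X in _ - X]mulmxA (projK basis) // subrr.
have [s3 s3E] : {s3 | s3 = exec append s2} by eexists.
have [||s3P v3 [a _ q3]] := arnoldi_append s3E s2P _ Pe0.
- by rewrite e2 v2.
- move: m_le; rewrite leq_eqVlt => /predU1P[mE|m_lt].
    by exists 1; rewrite scale1r e2 mE.
  by exists 0; rewrite scale0r v2 //; apply: R0; rewrite m_lt /=.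
rewrite -s3E; split=> // i; exact: spans_zero_row_append v3 q3 Pe0 (span2 i).
Qed.

Lemma exec_init_residuals s :
    ireg s 0 = n -> ireg s 1 = k -> ireg s rJ = 0%N ->
    (forall l, cell s aD l 0 = d l) -> (forall l c, cell s aX l c = x l c) ->
    (forall l c, cell s aQ l c = 0) -> (forall l c, cell s aR l c = 0) ->
  arnoldi (exec init_residuals s) 0.
Proof.
move=> rn rk rj dE xE Q0 R0.
have [s1 s1E] : {s1 | s1 = exec init_residuals s} by eexists.
rewrite -s1E.
have cs1 a l c : a != aR -> cell s1 a l c = cell s a l c.
  by move=> aP; rewrite s1E exec_array //= !inE; lia.
have R1 l c : cell s1 aR l c = if (l < n)%N && (c < k + k)%N then x l c else 0.
  pose P b s' := [/\ ireg s' 0 = n, forall l c, cell s' aX l c = x l c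
    & forall l c, cell s' aR l c = if (l < n)%N && (c < b)%N then x l c else 0].
  suff [_ _ ->] : P (k + k)%N s1 by [].
  have <- : ieval (ireg s) v2K = (k + k)%N by rewrite /= rk.
  rewrite s1E; apply: for_ind; first by split=> // l' c'; rewrite ltn0 andbF R0.
  move=> b s2 _ [rn2 xE2 R2]; split; first by rewrite exec_reg.
    by move=> l' c'; rewrite exec_array //= xE2.
  move=> l' c'; rewrite (exec_fill_loop (f := fun l => x l b) (J := b) (m := n)) //.
  - rewrite /= R2 (ltnS c') (leq_eqVlt c'); have [->|_] := eqVneq c' b.
      by rewrite ltnn !andbF andbT.
    by rewrite !andbF.
  - by move=> s3 rs /=; rewrite rs.
  by move=> l3 s3 l3_lt rs cs /=; rewrite !rs /= cs //= xE2.
have v0 : vec s1 aQ 0 = 0 by apply/colP=> l; rewrite !mxE cs1 // Q0.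
split=> //.
- by rewrite s1E !exec_reg.
- by split=> *; rewrite cs1.
- rewrite /proj big_ord0; split=> [c c_lt|]; apply/colP=> l.
    by rewrite mul0mx subr0 !mxE R1 ltn_ord c_lt.
  by rewrite v0 !mulmx0 subr0 !mxE R1 ltnn andbF.
Qed.

(** * Writing the result *)

Lemma exec_write_far_entries s t : ireg s 0 = n -> ireg s 1 = k -> ireg s rT = t ->
  forall a i i', cell (exec write_far_entries s) a i i' =
    if [&& a == aH, (i < n)%N & i' == t]
    then if (t.+1 < i)%N then 0 else \sum_(c < k)
      (cell s aF c i * (cell s aF (k + c) t)^* - cell s aF (k + c) i * (cell s aF c t)^*)
    else cell s a i i'.
Proof.
move=> rn rk rt.
pose g i := if (t.+1 < i)%N then 0 else \sum_(c < k)
  (cell s aF c i * (cell s aF (k + c) t)^* - cell s aF (k + c) i * (cell s aF c t)^*).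
pose P b s' := [/\ ireg s' 0 = n, ireg s' 1 = k, ireg s' rT = t
  & forall a i i', cell s' a i i' =
      if [&& a == aH, (i < b)%N & i' == t] then g i else cell s a i i'].
suff [] : P n (exec write_far_entries s) by [].
have <- : ieval (ireg s) vN = n by [].
apply: for_ind; first by split=> // a i i'; rewrite ltn0 andbF.
rewrite [ieval _ _]rn => i s1 i_lt [rn1 rk1 rt1 cs1]; split; try by rewrite exec_reg.
have gP a l c :
    (if [&& a == aH, l == i & c == t] then g i else cell s1 a l c) =
    (if [&& a == aH, (l < i.+1)%N & c == t] then g l else cell s a l c).
  rewrite cs1 (ltnS l) (leq_eqVlt l); have [->|_] := eqVneq l i; last by rewrite andbF.
  by rewrite ltnn andbF /=; case: [&& _ & _].
have tE : ieval (ireg (set_ireg s1 rI i)) (IAdd vT (ILit 2)) = t.+2.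
  by rewrite /= rt1 addn2.
move=> a l c; rewrite -gP exec_iif tE [ieval _ vI]/=; case: ifP => ti.
  by rewrite /= rt1 /g ti.
rewrite (exec_sum_loop (f := fun c => cell s aF c i * (cell s aF (k + c) t)^*
  - cell s aF (k + c) i * (cell s aF c t)^*) (I := i) (J := t) (m := k)) //.
- by rewrite /g ti.
- by move=> s2 rs /=; rewrite !rs.
by move=> c' s2 _ rs cs /=; rewrite !rs /= rk1 rt1 !cs // !cs1.
Qed.

Lemma exec_apply_matrix s j t : (t < j)%N -> ireg s rT = t -> arnoldi s j ->
  forall l : 'I_n, cell (exec apply_matrix s) aW l 0 = (A *m vec s aQ t.+1) l 0.
Proof.
move=> t_lt rt [[rn rk _] [dE xE] _ _ coefF] l.
have [s1 s1E] : {s1 | s1 = exec (fill_loop aW rL vN 0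
  (CBin BMul (CCell aD vL 0) (CCell aQ vL (vT + 1)))) s} by eexists.
have cs1 a i i' : cell s1 a i i' = if [&& a == aW, (i < n)%N & i' == 0%N]
    then d i * cell s aQ i t.+1 else cell s a i i'.
  rewrite s1E; apply: (exec_fill_loop (f := fun i => d i * cell s aQ i t.+1)) => //.
  by move=> l' s' _ rs cs /=; rewrite !rs /= !cs // dE rt addn1.
pose P b s' := [/\ ireg s' 0 = n, ireg s' 1 = k, ireg s' rT = t
  & forall a i i', cell s' a i i' = if [&& a == aW, (i < n)%N & i' == 0%N]
    then d i * cell s aQ i t.+1
         + \sum_(c < b) x i c * (cell s aF (k + c) t)^* else cell s1 a i i'].
suff [_ _ _ ->] : P k (exec apply_matrix s).
  rewrite /= ltn_ord /= mulmxDl -mulmxA [RHS]mxE [X in _ = _ + X]mxE mul_diag_mx.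
  congr (_ + _); first by rewrite !mxE.
  apply: eq_bigr => c _; rewrite coefF ?ltn_add2l // [U l c]mxE; congr (_ * _).
  by rewrite (adj_mul_xcol _ (c' := (k + c)%N)) // => m; rewrite mxE.
rewrite /apply_matrix exec_seq -s1E.
have <- : ieval (ireg s1) vK = k by rewrite /= s1E exec_reg.
apply: for_ind.
  split; try by rewrite s1E exec_reg.
  by move=> a i i'; rewrite big_ord0 addr0 cs1; case: [&& _, _ & _].
move=> c s2 _ [rn2 rk2 rt2 cs2]; split; try by rewrite exec_reg.
move=> a i i'.
rewrite (exec_fill_loop (f := fun i => d i * cell s aQ i t.+1
   + \sum_(c' < c.+1) x i c' * (cell s aF (k + c') t)^*) (J := 0%N) (m := n)) //.
  by rewrite /= cs2; case: [&& _, _ & _].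
move=> i2 s3 i2_lt rs cs /=; rewrite !rs /= rt2 rk2 !cs ?ltnn ?andbF //.
by rewrite !cs2 /= i2_lt /= !cs1 /= xE big_ord_recr /= addrA.
Qed.

Lemma exec_write_entry s i t b (w : 'cV[C]_n) :
    ireg s 0 = n -> ireg s rT = t -> (forall l : 'I_n, cell s aW l 0 = w l 0) ->
    (forall s', (forall y, y != rL -> ireg s' y = ireg s y) -> ieval (ireg s') b = i) ->
  forall a i1 i2, cell (exec (write_entry b) s) a i1 i2 =
    if [&& a == aH, i1 == i & i2 == t] then ((vec s aQ i.+1)^t* *m w) 0 0
    else cell s a i1 i2.
Proof.
move=> rn rt wE bE a i1 i2.
rewrite (exec_sum_loop (f := fun l => (cell s aQ l i.+1)^* * cell s aW l 0)
  (I := i) (J := t) (m := n)) //.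
- case: ifP => // _; rewrite mxE; apply: eq_bigr => l _.
  by rewrite wE !mxE.
- by move=> s' rs; rewrite bE //= rs.
move=> l s' l_lt rs cs /=; rewrite bE => [|y yL]; last by rewrite rs (negPf yL).
by rewrite !rs /= !cs // addn1.
Qed.

Lemma exec_write_column s t : (t < n)%N -> ireg s rT = t -> arnoldi s n ->
  forall i i', (i < n)%N -> cell (exec write_column s) aH i i' =
    if i' == t then ((vec s aQ i.+1)^t* *m (A *m vec s aQ t.+1)) 0 0
    else cell s aH i i'.
Proof.
move=> t_lt rt sP i i' i_lt.
have [[rn rk _] _ basis _ coefF] := sP.
rewrite /write_column 4!exec_seq.
have [s1 s1E] : {s1 | s1 = exec write_far_entries s} by eexists.
have cs1 := exec_write_far_entries rn rk rt; rewrite -s1E in cs1.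
have rs1 y : y \notin [:: rI; rC] -> ireg s1 y = ireg s y.
  by rewrite !inE => yN; rewrite s1E exec_reg //= !inE; lia.
have v1 c : vec s1 aQ c = vec s aQ c.
  by apply/colP=> l; rewrite !mxE cs1.
have s1P : arnoldi s1 n.
  apply: eq_arnoldi sP => [y y_lt|a l c aP]; first by rewrite rs1 // !inE; lia.
  by rewrite s1E exec_array //; move: aP; rewrite !inE; lia.
have [s2 s2E] : {s2 | s2 = exec apply_matrix s1} by eexists.
have w2 : forall l : 'I_n, cell s2 aW l 0 = (A *m vec s aQ t.+1) l 0.
  by move=> l; rewrite s2E -v1; apply: exec_apply_matrix s1P l; rewrite ?rs1.
have cs2 a l c : a != aW -> cell s2 a l c = cell s1 a l c.
  by move=> aW'; rewrite s2E exec_array //= !inE; lia.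
have rs2 y : y \notin [:: rI; rC; rL] -> ireg s2 y = ireg s y.
  by rewrite !inE => yN; rewrite s2E exec_reg ?rs1 //= !inE; lia.
have v2 c : vec s2 aQ c = vec s aQ c.
  by apply/colP=> l; rewrite !mxE cs2 // cs1.
rewrite -s1E -s2E.
have [s3 s3E] : {s3 | s3 = exec (write_entry (vT - 1)%ix) s2} by eexists.
have cs3 a i1 i2 : cell s3 a i1 i2 = if [&& a == aH, i1 == (t - 1)%N & i2 == t]
    then ((vec s aQ (t - 1).+1)^t* *m (A *m vec s aQ t.+1)) 0 0
    else cell s2 a i1 i2.
  rewrite s3E (exec_write_entry (i := t - 1) (t := t) (w := A *m vec s aQ t.+1)) ?rs2 //.
    by rewrite v2.
  by move=> s' rs /=; rewrite rs // rs2 // rt.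
have rs3 y : y \notin [:: rI; rC; rL] -> ireg s3 y = ireg s y.
  by rewrite !inE => yN; rewrite s3E exec_reg ?rs2 //= !inE; lia.
have v3 c : vec s3 aQ c = vec s aQ c by rewrite -v2; apply/colP=> l; rewrite !mxE cs3.
have [s4 s4E] : {s4 | s4 = exec (write_entry vT) s3} by eexists.
have cs4 a i1 i2 : cell s4 a i1 i2 = if [&& a == aH, i1 == t & i2 == t]
    then ((vec s aQ t.+1)^t* *m (A *m vec s aQ t.+1)) 0 0
    else cell s3 a i1 i2.
  rewrite s4E (exec_write_entry (i := t) (t := t) (w := A *m vec s aQ t.+1)) ?rs3 //.
  - by rewrite v3.
  - by move=> l; rewrite cs3 /= w2.
  by move=> s' rs /=; rewrite rs // rs3 // rt.
have rs4 y : y \notin [:: rI; rC; rL] -> ireg s4 y = ireg s y.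
  by rewrite !inE => yN; rewrite s4E exec_reg ?rs3 //= !inE; lia.
have v4 c : vec s4 aQ c = vec s aQ c by rewrite -v3; apply/colP=> l; rewrite !mxE cs4.
rewrite -s3E -s4E.
rewrite (exec_write_entry (i := t.+1) (t := t) (w := A *m vec s aQ t.+1)) ?rs4 //.
- rewrite v4 cs4 cs3 cs2 //= cs1 /= i_lt.
  have [->|_] := eqVneq i' t; last by rewrite !andbF.
  rewrite !andbT; have [->//|it1] := eqVneq i t.+1.
  have [->//|it] := eqVneq i t; have [->//|it2] := eqVneq i (t - 1)%N.
  case: ltnP => [ti|it3]; first by rewrite (hess_entry0 basis) // mxE.
  rewrite (hess_entry_skew diag_herm basis) //; last by lia.
  rewrite mxE [X in _ = X + _]mxE [X in _ = _ + X]mxE [X in _ - X]mxE -sumrB.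
  apply: eq_bigr => c _.
  have c_lt : (c < k + k)%N by rewrite ltn_addr.
  have kc_lt : (k + c < k + k)%N by rewrite ltn_add2l.
  have UE l : U l c = x l c by rewrite mxE.
  have VE l : V l c = x l (k + c)%N by rewrite mxE.
  by rewrite !coefF // !(mul_xcol _ _ UE) !(mul_xcol _ _ VE)
             !(adj_mul_xcol _ UE) !(adj_mul_xcol _ VE).
- by move=> l; rewrite cs4 /= cs3 /= w2.
by move=> s' rs /=; rewrite rs // rs4 // rt addn1.
Qed.

Lemma exec_write_output s : arnoldi s n -> forall i j : 'I_n,
  cell (exec write_output s) aH i j
  = ((vec s aQ i.+1)^t* *m (A *m vec s aQ j.+1)) 0 0.
Proof.
move=> sP i j; have [[rn _ _] _ _ _ _] := sP.
pose P t s' := [/\ arnoldi s' n, forall c, vec s' aQ c = vec s aQ c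
  & forall i j : 'I_n, (j < t)%N -> cell s' aH i j
      = ((vec s aQ i.+1)^t* *m (A *m vec s aQ j.+1)) 0 0].
suff [_ _ ->] : P n (exec write_output s) by [].
have <- : ieval (ireg s) vN = n by [].
apply: for_ind; first by split.
rewrite [ieval _ _]rn => t s1 t_lt [s1P v1 h1].
have cw a l c : a != aW -> a != aH ->
  cell (exec write_column (set_ireg s1 rT t)) a l c = cell s1 a l c.
  by move=> aW' aH'; rewrite exec_array //= !inE; lia.
have s1P' : arnoldi (set_ireg s1 rT t) n.
  by apply: eq_arnoldi s1P => // y y_lt /=; rewrite ifN //; lia.
split.
- apply: eq_arnoldi s1P => [y y_lt|a l c aP].
    by rewrite exec_reg /= ?inE ?ifN //; lia.
  by rewrite exec_array //; move: aP; rewrite !inE; lia.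
- by move=> c; rewrite -v1; apply/colP=> l; rewrite !mxE cw.
move=> i1 i2; rewrite ltnS leq_eqVlt => i2_le.
rewrite (exec_write_column t_lt _ s1P') //= ?eqxx //.
case/predU1P: i2_le => [<-|i2_lt]; first by rewrite eqxx -!v1.
by rewrite ltn_eqF // h1.
Qed.

End Arnoldi.

(** * Correctness of the deflation *)

Section Deflate.
Variables (C : numClosedFieldType) (n K : nat) (d : nat -> C).
Implicit Types (x : nat -> nat -> C) (lead : nat -> nat -> bool).

(** The state of the elimination when it has treated the rows before [i] and
    the first [c] entries of row [i]; [found] tells that the first nonzero
    entry of row [i] is among them. *)
Definition reduced (i c : nat) (found : bool) x lead : Prop :=
  [/\ forall m c, lead m c -> x m c != 0 /\ forall c', (c' < c)%N -> x m c' = 0,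
      forall m m' c, lead m c -> lead m' c -> d m = d m' -> m = m',
      forall m c, lead m c -> (c < K)%N /\ ((m < i)%N \/ m = i /\ found),
      forall m, (m < i)%N ->
        (forall c, (c < K)%N -> x m c = 0) \/ exists2 c, (c < K)%N & lead m c
    & if found then exists2 c, (c < K)%N & lead i c
      else forall c', (c' < c)%N -> x i c' = 0].

Lemma reduced_echelon x lead : reduced n 0 false x lead -> echelon n K d x lead.
Proof. by case. Qed.

Lemma reduced_next_row i found x lead :
  reduced i K found x lead -> reduced i.+1 0 false x lead.
Proof.
move=> [leadP lead_inj leadK lead_ex row_i]; split=> //.
  move=> m c /leadK[c_lt m_le]; split=> //; left.
  by case: m_le => [/leqW|[->]].
move=> m; rewrite ltnS leq_eqVlt => /predU1P[->|/lead_ex //].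
by case: found row_i {leadK}; [right|left].
Qed.

Lemma reduced_found i c x lead :
  reduced i c true x lead -> reduced i c.+1 true x lead.
Proof. by case. Qed.

Lemma reduced_zero i c x lead :
  reduced i c false x lead -> x i c = 0 -> reduced i c.+1 false x lead.
Proof.
move=> [leadP lead_inj leadK lead_ex row_i] xic0; split=> // c'.
by rewrite ltnS leq_eqVlt => /predU1P[->|/row_i].
Qed.

Lemma reduced_new_lead i c x lead lead' : (c < K)%N ->
    reduced i c false x lead -> x i c != 0 ->
    (forall m, lead m c -> d m != d i) ->
    (forall m c', lead' m c' = (m == i) && (c' == c) || lead m c') ->
  reduced i c.+1 true x lead'.
Proof.
move=> c_lt [leadP lead_inj leadK lead_ex row_i] xic nolead lead'E; split.
- by move=> m c'; rewrite lead'E => /orP[/andP[/eqP-> /eqP->]|/leadP].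
- move=> m m' c'; rewrite !lead'E.
  case/orP=> [/andP[/eqP-> /eqP->]|mc'].
    by rewrite eqxx andbT => /orP[/eqP ->//|/nolead/eqP m'i /esym].
  case/orP=> [/andP[/eqP-> /eqP c'c]|m'c']; last exact: lead_inj m'c'.
  by move: mc'; rewrite c'c => /nolead/eqP.
- move=> m c'; rewrite lead'E => /orP[/andP[/eqP-> /eqP->]|/leadK[? [|[]//]]].
    by split=> //; right.
  by split=> //; left.
- move=> m m_lt; have [|[c' c'_lt mc']] := lead_ex m m_lt; first by left.
  by right; exists c'; rewrite // lead'E mc' orbT.
by exists c; rewrite // lead'E !eqxx.
Qed.

(** A rotation with the row [p] whose leading entry lies in the same column
    keeps that leading entry and cancels the entry of row [i]. *)
Lemma reduced_rotate i c p a b x x' lead : (c < K)%N ->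
    reduced i c false x lead -> lead p c ->
    a^* * x p c + b^* * x i c != 0 -> a * x i c - b * x p c = 0 ->
    (forall m c', (c' < K)%N -> x' m c' =
       if m == p then a^* * x p c' + b^* * x i c'
       else if m == i then a * x i c' - b * x p c' else x m c') ->
  reduced i c.+1 false x' lead.
Proof.
move=> c_lt [leadP lead_inj leadK lead_ex row_i] pc x'pc x'ic x'E.
have p_lt : (p < i)%N by have [_ [|[]//]] := leadK _ _ pc.
have [xpc xp0] := leadP _ _ pc.
have i_neq_p : (i == p) = false by rewrite gtn_eqF.
split=> //.
- move=> m c' mc'; have [xmc' xm0] := leadP _ _ mc'.
  have [c'_lt m_le] := leadK _ _ mc'.
  have m_neq_i : (m == i) = false by rewrite ltn_eqF //; case: m_le => // -[].
  have [mp|m_neq_p] := eqVneq m p.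
    have c'c : c' = c.
      move: xmc' xm0; rewrite {}mp => xpc' xp0'.
      have [cc'|cc'|//] := ltngtP c' c; first by rewrite xp0 ?eqxx in xpc'.
      by rewrite xp0' ?eqxx in xpc.
    rewrite {}mp c'c x'E // eqxx; split=> // c'' c''_lt.
    by rewrite x'E ?eqxx ?(ltn_trans c''_lt) // xp0 // row_i // !mulr0 addr0.
  rewrite x'E // (negPf m_neq_p) m_neq_i; split=> // c'' c''_lt.
  by rewrite x'E ?(ltn_trans c''_lt) // (negPf m_neq_p) m_neq_i xm0.
- move=> m m_lt; have [xm0|] := lead_ex m m_lt; last by right.
  have [mp|m_neq_p] := eqVneq m p; first by rewrite -mp xm0 ?eqxx in xpc.
  by left=> c' c'_lt; rewrite x'E // (negPf m_neq_p) ltn_eqF // xm0.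
move=> c'; rewrite ltnS leq_eqVlt => /predU1P[->|c'_lt].
  by rewrite x'E // eqxx i_neq_p.
by rewrite x'E ?(ltn_trans c'_lt) // eqxx i_neq_p row_i // xp0 // !mulr0 subr0.
Qed.

End Deflate.

Section ExecDeflate.
Variables (C : numClosedFieldType) (n k : nat).
Implicit Types s : state C.

Lemma exec_find_pivot s i c (m := ireg (exec find_pivot s) rM) :
    ireg s 0 = n -> ireg s rI = i -> ireg s rC = c ->
  [/\ (m < n)%N, cell s aB m c != 0 & cell s aD m 0 = cell s aD i 0] \/
  m = n /\ forall p, (p < n)%N -> cell s aB p c != 0 -> cell s aD p 0 != cell s aD i 0.
Proof.
move=> rn ri rc.
have [s1 s1E] : {s1 | s1 = exec (ISet rM vN) s} by eexists.
pose P b s' := [/\ ireg s' rI = i, ireg s' rC = c,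
  forall a i i', cell s' a i i' = cell s a i i' & let m := ireg s' rM in
  [/\ (m < n)%N, cell s aB m c != 0 & cell s aD m 0 = cell s aD i 0] \/
  m = n /\ forall p, (p < b)%N -> cell s aB p c != 0 -> cell s aD p 0 != cell s aD i 0].
suff [] : P n (exec find_pivot s) by [].
rewrite /find_pivot exec_seq -s1E.
have <- : ieval (ireg s1) vN = n by rewrite s1E.
apply: for_ind; first by rewrite s1E; split=> //=; right; rewrite rn.
have -> : ieval (ireg s1) vN = n by rewrite s1E.
move=> p s2 p_lt [ri2 rc2 cs2 mP]; rewrite /= rc2 !cs2 ri2.
case: eqP => [Bp|/eqP Bp]; last case: eqP => [dp|/eqP dp]; split=> //=.
- case: mP => [|[mn noP]]; [by left|right; split=> // p'].
  by rewrite ltnS leq_eqVlt => /predU1P[->|/noP//]; rewrite Bp eqxx.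
- by left.
case: mP => [|[mn noP]]; [by left|right; split=> // p'].
by rewrite ltnS leq_eqVlt => /predU1P[->|/noP//].
Qed.

Lemma exec_rotate s p i c (x := cell s aX) :
    ireg s 1 = k -> ireg s rM = p -> ireg s rI = i -> ireg s rC = c -> p != i ->
    x p c != 0 ->
  exists a b, [/\ a * a^* + b * b^* = 1, a^* * x p c + b^* * x i c != 0,
    a * x i c - b * x p c = 0
    & forall m c', (c' < k + k)%N -> cell (exec rotate s) aX m c' =
       if m == p then a^* * x p c' + b^* * x i c'
       else if m == i then a * x i c' - b * x p c' else x m c'].
Proof.
move=> rk rm ri rc p_neq_i xpc.
pose r2 := x p c * (x p c)^* + x i c * (x i c)^*.
have r2_gt0 : 0 < r2.
  by rewrite ltr_wpDr ?mul_conjC_ge0 // lt_neqAle mul_conjC_ge0 eq_sym mul_conjC_eq0 xpc.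
pose r := sqrtC r2; have r_gt0 : 0 < r by rewrite sqrtC_gt0.
have rV_conj : r^-1^* = r^-1 by rewrite conj_Creal // realV gtr0_real.
have rr : r * r = r2 by rewrite -expr2 sqrtCK.
have r_neq0 : r != 0 by rewrite gt_eqF.
pose a := x p c / r; pose b := x i c / r.
have aC : a^* = (x p c)^* / r by rewrite rmorphM /= rV_conj.
have bC : b^* = (x i c)^* / r by rewrite rmorphM /= rV_conj.
exists a, b; split.
- rewrite aC bC /a /b; apply: (mulfI (mulf_neq0 r_neq0 r_neq0)).
  by rewrite [in RHS]rr /r2; field.
- suff -> : a^* * x p c + b^* * x i c = r by [].
  by rewrite aC bC; apply: (mulfI r_neq0); rewrite rr /r2; field.
- by rewrite /a /b; field.
pose loop := For rP v2K
  (Seq (CSet aS (ILit 3) 0 (CCell aX vM vP))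
  (Seq (CSet aX vM vP (conj (CCell aS 0 0) * CCell aS (ILit 3) 0
          + conj (CCell aS 1 0) * CCell aX vI vP))
       (CSet aX vI vP (CCell aS 0 0 * CCell aX vI vP
          - CCell aS 1 0 * CCell aS (ILit 3) 0)))).
have [s1 [s1E rs1 S0 S1 X1]] : exists s1, [/\ exec rotate s = exec loop s1,
    ireg s1 = ireg s, cell s1 aS 0 0 = a, cell s1 aS 1 0 = b
  & forall l m, cell s1 aX l m = x l m].
  eexists; split; [reflexivity | reflexivity | | |] => //=;
  by rewrite rm rc ri /= -/(x p c) -/(x i c) -/r2 ltW.
pose y m c' := if m == p then a^* * x p c' + b^* * x i c'
       else if m == i then a * x i c' - b * x p c' else x m c'.
pose P t s' := [/\ [/\ ireg s' rM = p & ireg s' rI = i], cell s' aS 0 0 = a,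
  cell s' aS 1 0 = b
  & forall l m, cell s' aX l m = if (m < t)%N then y l m else x l m].
suff [_ _ _ XE] : P (k + k)%N (exec rotate s) by move=> m c' c'_lt; rewrite XE c'_lt.
have <- : ieval (ireg s1) v2K = (k + k)%N by rewrite /= rs1 rk.
rewrite s1E; apply: for_ind; first by rewrite /P rs1.
move=> t s2 _ [[rm2 ri2] S02 S12 X2]; rewrite /P /= rm2 ri2; split=> //.
move=> l m; rewrite S02 S12 !X2 ltnS [(m <= t)%N]leq_eqVlt ltnn /=.
have i_neq_p : (i == p) = false by rewrite eq_sym (negPf p_neq_i).
rewrite !eqxx i_neq_p /=.
have [->|_] := eqVneq m t; last by rewrite !andbF.
rewrite ltnn !andbT /y /=.
have [->|_] := eqVneq l i; first by rewrite i_neq_p.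
by case: eqP.
Qed.

Section Invariant.
Variable s0 : state C.
Let d l := cell s0 aD l 0.
Let D : 'M[C]_n := diag_mx (\row_(l < n) d l).

Definition rows s : 'M[C]_(n, k + k) := \matrix_(l, c) cell s aX l c.

Definition deflating i c s : Prop :=
  [/\ [/\ ireg s 0 = n, ireg s 1 = k & ireg s rI = i],
      forall l, cell s aD l 0 = d l,
      exists G : 'M[C]_n,
        [/\ G \is unitarymx, G *m D = D *m G & rows s = G *m rows s0]
    & reduced (k + k) d i c (ireg s rF != 0)%N (cell s aX)
        (fun m c => cell s aB m c != 0)].

Lemma exec_reduce_entry s i c : (i < n)%N -> (c < k + k)%N -> ireg s rC = c ->
  deflating i c s -> deflating i c.+1 (exec reduce_entry s).
Proof.
move=> i_lt c_lt rc [[rn rk ri] dE [G [Gu GD XG]] red].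
rewrite /reduce_entry exec_iif [ieval _ vF]/= [ieval _ (ILit 0)]/= leqn0.
case: eqP red => [rf|rf] red; last first.
  by split=> //; [exists G | move/eqP/negPf: rf red => -> /= /reduced_found].
have [s1 s1E] : {s1 | s1 = exec find_pivot s} by eexists.
have rs1 y : y \notin [:: rM; rP] -> ireg s1 y = ireg s y.
  by rewrite !inE => yN; rewrite s1E exec_reg //= !inE; lia.
have cs1 a l m : cell s1 a l m = cell s a l m by rewrite s1E exec_array.
have pivotP := exec_find_pivot rn ri rc; rewrite -s1E in pivotP.
have red1 : reduced (k + k) d i c false (cell s1 aX) (fun m c => cell s1 aB m c != 0).
  case: red => leadP lead_inj leadK lead_ex row_i.
  split; [move=> m c'|move=> m m' c'|move=> m c'|move=> m|];
    rewrite ?cs1; [move=> /leadP[? xm0]|exact: lead_inj|exact: leadK| |].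
  - by split=> // c'' ?; rewrite cs1 xm0.
  - move=> /lead_ex[xm0|[c' ? ?]]; [left=> c' ?|right; exists c'] => //.
      by rewrite cs1 xm0.
    by rewrite cs1.
  by move=> c' ?; rewrite cs1 row_i.
have X1 : rows s1 = G *m rows s0 by rewrite -XG; apply/matrixP=> l m; rewrite !mxE cs1.
rewrite exec_seq -s1E exec_iif [ieval _ vN]/= [ieval _ vM]/= rs1 // rn.
case: pivotP => [[p_lt Bp dp]|[-> noP]]; last first.
  rewrite leqnn /= cs1 !rs1 // ri rc; case: eqP => [x0|/eqP x0].
    split=> //; first by rewrite !rs1.
    - by move=> l; rewrite cs1.
    - by exists G.
    by rewrite /= rs1 // rf; apply: reduced_zero; rewrite ?cs1.
  split=> /=; first by rewrite !rs1.
  - by move=> l; rewrite cs1.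
  - by exists G; split=> //; rewrite -X1; apply/matrixP=> l m; rewrite !mxE.
  apply: (reduced_new_lead c_lt red1); first by rewrite cs1.
    move=> m; rewrite cs1 => Bm; rewrite -!dE; apply: noP => //.
    by have [_ _ /(_ m c)] := red; case=> // _ [/ltn_trans->//|[]].
  by move=> m c'; case: (_ && _); rewrite //= oner_eq0.
rewrite ifN -?ltnNge //.
set p := ireg s1 rM in p_lt Bp dp *.
have p_lt_i : (p < i)%N by have [_ _ /(_ p c Bp)] := red; case=> // _ [|[]] //; rewrite rf.
have p_neq_i : p != i by rewrite ltn_eqF.
have [leadP _ _ _ _] := red1.
have Bp1 : cell s1 aB p c != 0 by rewrite cs1.
have [xpc _] := leadP _ _ Bp1.
have rk1 : ireg s1 1 = k by rewrite rs1.
have ri1 : ireg s1 rI = i by rewrite rs1.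
have rc1 : ireg s1 rC = c by rewrite rs1.
have := exec_rotate rk1 (erefl p) ri1 rc1 p_neq_i xpc.
have [s2 s2E] : {s2 | s2 = exec rotate s1} by eexists.
rewrite -s2E => -[a [b [ab1 xpc' xic' XE]]].
have rs2 y : y \notin [:: rM; rP] -> ireg s2 y = ireg s y.
  by move=> yN; rewrite s2E exec_reg ?rs1 //; move: yN; rewrite /= !inE; lia.
have cs2 a' l m : a' \notin [:: aX; aS] -> cell s2 a' l m = cell s a' l m.
  by rewrite !inE => aP; rewrite s2E exec_array ?cs1 //= !inE; lia.
split; first by rewrite !rs2.
- by move=> l; rewrite cs2.
- pose po := Ordinal p_lt; pose io := Ordinal i_lt.
  exists (givens_mx a b po io *m G); split.
  + by rewrite mul_unitarymx // givens_unitary.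
  + rewrite -mulmxA GD !mulmxA givens_comm // !mxE /d -/(d p) -/(d i).
    by rewrite -!dE.
  rewrite -mulmxA -X1; apply/matrixP=> l m.
  by rewrite mul_givens_mx // !mxE XE // !cs1.
rewrite rs2 // rf /=.
have red2 : reduced (k + k) d i c.+1 false (cell s2 aX) (fun m c => cell s1 aB m c != 0).
  by apply: reduced_rotate red1 _ xpc' xic' XE => //; rewrite cs1.
case: red2 => leadP' lead_inj leadK lead_ex row_i.
split=> //.
- by move=> m c'; rewrite cs2 // -cs1 => /leadP'.
- by move=> m m' c'; rewrite !cs2 // -!cs1; apply: lead_inj.
- by move=> m c'; rewrite cs2 // -cs1; apply: leadK.
move=> m /lead_ex[|[c' c'_lt mc']]; first by left.
by right; exists c'; rewrite // cs2 // -cs1.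
Qed.

Lemma exec_deflate :
    ireg s0 0 = n -> ireg s0 1 = k -> (forall l c, cell s0 aB l c = 0) ->
  deflating n 0 (set_ireg (set_ireg (exec deflate s0) rI n) rF 0).
Proof.
move=> rn rk B0.
pose P i s := deflating i 0 (set_ireg (set_ireg s rI i) rF 0).
suff: P n (exec deflate s0) by [].
have <- : ieval (ireg s0) vN = n by [].
apply: for_ind.
  split=> //=; last by split=> // [m c|m m' c|m c]; rewrite B0 eqxx.
  exists 1%:M; split; last by rewrite mul1mx.
    by apply/unitarymxP; rewrite trmx1 map_mx1 mul1mx.
  by rewrite mul1mx mulmx1.
rewrite [ieval _ _]rn => i s i_lt sP; rewrite exec_seq.
set s1 := exec (ISet rF _) _.
have s1P : deflating i 0 s1 by [].
have [[_ rk1 _] _ _ _] := s1P.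
have [s2 s2E] : {s2 | s2 = exec (For rC v2K reduce_entry) s1} by eexists.
rewrite -s2E; suff [[rn2 rk2 ri2] dE2 X2 red2] : deflating i (k + k) s2.
  by split=> //; apply: reduced_next_row red2.
have <- : ieval (ireg s1) v2K = (k + k)%N by rewrite /= -[in RHS]rk1.
rewrite s2E; apply: for_ind => // c s3 c_lt s3P.
apply: exec_reduce_entry => //.
by move: c_lt; rewrite [ieval _ _]/= -[in X in _ -> X]rk1.
Qed.

End Invariant.

End ExecDeflate.

(** * The whole program *)

Lemma exec_gather (C : numClosedFieldType) n k (s s' : state C) :
    s' = exec gather s -> ireg s 0 = n -> ireg s 1 = k ->
  forall l c, (l < n)%N -> (c < k)%N ->
    cell s' aX l c = cell s aU l c /\ cell s' aX l (k + c) = cell s aV l c.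
Proof.
move=> -> rn rk.
pose done_ (s' : state C) l c :=
  cell s' aX l c = cell s aU l c /\ cell s' aX l (k + c) = cell s aV l c.
pose P b s' := [/\ ireg s' 0 = n, ireg s' 1 = k,
  forall l c, cell s' aU l c = cell s aU l c /\ cell s' aV l c = cell s aV l c
  & forall l c, (l < b)%N -> (c < k)%N -> done_ s' l c].
suff [] : P n (exec gather s) by [].
have <- : ieval (ireg s) vN = n by [].
apply: for_ind; first by split.
move=> b s1 _ [rn1 rk1 UV1 done1].
pose P' b' s' := [/\ ireg s' rL = b, ireg s' 0 = n, ireg s' 1 = k,
  forall l c, cell s' aU l c = cell s aU l c /\ cell s' aV l c = cell s aV l c
  & forall l c, (l < b)%N || (l == b) && (c < b')%N -> (c < k)%N -> done_ s' l c].
set body := For _ _ _; set s2 := set_ireg s1 _ b.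
suff [_ ? ? ? doneb] : P' k (exec body s2).
  split=> // l c; rewrite ltnS leq_eqVlt orbC => l_le c_lt.
  by apply: doneb; rewrite // c_lt andbT.
have <- : ieval (ireg s2) vK = k by [].
apply: for_ind.
  by split=> // l c; rewrite andbF orbF; apply: done1.
rewrite [ieval _ _]/= rk1 => c s3 c_lt [rl3 rn3 rk3 UV3 done3].
split=> //.
move=> l c' lc' c'_lt; rewrite /done_ /= !rl3 !rk3.
have [U3 V3] := UV3 b c; rewrite U3 V3 eqn_add2l.
case: (eqVneq l b) lc' => [->|l_neq] lc'; last by apply: done3; rewrite ?(negPf l_neq).
have [->|c'_neq] := eqVneq c' c.
  by rewrite (_ : (c == k + c)%N = false) //; lia.
rewrite (_ : (c' == k + c)%N = false) 1?(_ : (k + c' == c)%N = false) /=; try lia.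
by apply: done3; rewrite // eqxx; lia.
Qed.

(** With [G] the product of the rotations and [Qc] the matrix of the basis, the
    basis is one for [G A G^*], since [G] commutes with [diag d]; the unitary
    matrix is therefore [Qc^* G]. *)
Lemma hessenberg_reduction_correct (C : numClosedFieldType) n k
    (d : 'rV[C]_n) (U V : 'M[C]_(n, k)) (s := exec hessenberg_reduction (init d U V)) :
    (forall i, (d 0 i)^* = d 0 i) ->
  let A := diag_mx d + U *m V^t* in
  upper_hessenberg (output n s) /\
  exists2 Q : 'M[C]_n, Q \is unitarymx & output n s = Q *m A *m Q^t*.
Proof.
move=> d_real A.
have [s0 s0E] : {s0 | s0 = init d U V} by eexists.
have d0 (i : 'I_n) : cell s0 aD i 0 = d 0 i.
  by rewrite s0E /= /vec_cell valK.
have d0_real l : (cell s0 aD l 0)^* = cell s0 aD l 0.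
  rewrite s0E /= /vec_cell; case: insubP => [i _ _|_]; last exact: rmorph0.
  by rewrite eqxx d_real.
have rn0 : ireg s0 0 = n by rewrite s0E.
have rk0 : ireg s0 1 = k by rewrite s0E.
have r0 y : (1 < y)%N -> ireg s0 y = 0%N by rewrite s0E; case: y => [|[]].
have c0 a l c : (2 < a)%N -> cell s0 a l c = 0 by rewrite s0E; case: a => [|[|[]]].
have [s1 s1E] : {s1 | s1 = exec gather s0} by eexists.
have X1 := exec_gather s1E rn0 rk0.
have c1 a l c : a != aX -> cell s1 a l c = cell s0 a l c.
  by move=> aX'; rewrite s1E exec_array //= !inE; lia.
have r1 y : y \notin [:: rL; rC] -> ireg s1 y = ireg s0 y.
  by rewrite !inE => yN; rewrite s1E exec_reg //= !inE; lia.
have [s2 s2E] : {s2 | s2 = exec deflate s1} by eexists.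
have [||l c|_ _ [G [Gu GD X2]] red] := exec_deflate (n := n) (k := k) (s0 := s1).
- by rewrite r1.
- by rewrite r1.
- by rewrite c1 ?c0.
rewrite -s2E in X2 red.
pose x := cell s2 aX; pose dd l := cell s0 aD l 0.
have ech : echelon n (k + k) dd x (fun m c => cell s2 aB m c != 0).
  have [leadP lead_inj lead_ex] := reduced_echelon red; split=> // m m' c mc m'c.
  by move=> dm; apply: (lead_inj _ _ _ mc m'c); rewrite !c1.
have c2 a l c : a \notin [:: aX; aB; aS] -> cell s2 a l c = cell s0 a l c.
  by rewrite !inE => aX'; rewrite s2E exec_array ?c1 //= ?inE; lia.
have r2 y : (y < 3)%N -> ireg s2 y = ireg s0 y.
  by move=> y_lt; rewrite s2E exec_reg ?r1 //= ?inE; lia.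
have [s3 s3E] : {s3 | s3 = exec init_residuals s2} by eexists.
have s3P : arnoldi n k dd x s3 0.
  rewrite s3E; apply: exec_init_residuals => //.
  - by rewrite r2.
  - by rewrite r2.
  - by rewrite r2 ?r0.
  - by move=> l; rewrite c2.
  - by move=> l c; rewrite c2 // c0.
  - by move=> l c; rewrite c2 // c0.
have [s4 s4E] : {s4 | s4 = exec append_zero_rows s3} by eexists.
have [j [j_le s4P span4]] := exec_append_zero_rows d0_real s3P.
rewrite -s4E in s4P span4.
have [s5 s5E] : {s5 | s5 = exec extend s4} by eexists.
have s5P : arnoldi n k dd x s5 n by rewrite s5E; apply: (exec_extend d0_real ech j_le).
have HE : output n s = \matrix_(i, j) cell (exec write_output s5) aH i j.
  by rewrite s5E s4E s3E s2E s1E s0E.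
have [_ _] := s5P; set A' := (X in hess_basis X) => basis _ _.
have [_ ortho _] := basis.
have entryE (i l : 'I_n) : cell (exec write_output s5) aH i l
    = ((vec n s5 aQ i.+1)^t* *m (A' *m vec n s5 aQ l.+1)) 0 0.
  exact: (exec_write_output d0_real s5P).
have A'E : A' = G *m A *m G^t*.
  have GG : G *m G^t* = 1%:M by apply/unitarymxP.
  have GDG : diag_mx d = G *m diag_mx d *m G^t*.
    rewrite (_ : diag_mx d = diag_mx (\row_(l < n) cell s1 aD l 0)).
      by rewrite GD -mulmxA GG mulmx1.
    by congr diag_mx; apply/rowP=> l; rewrite mxE c1 ?d0.
  rewrite /A mulmxDr mulmxDl -GDG /A'; congr (_ + _).
    by congr diag_mx; apply/rowP=> l; rewrite mxE; apply: d0.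
  rewrite !mulmxA -mulmxA -adjM; congr (_ *m _^t*).
    apply/matrixP=> l c; have /matrixP/(_ l (lshift k c)) := X2.
    rewrite !mxE => XE; apply: etrans XE _; apply: eq_bigr => m _; rewrite mxE.
    by have [-> _] := X1 m c (ltn_ord m) (ltn_ord c); rewrite s0E /= /mx_cell !valK.
  apply/matrixP=> l c; have /matrixP/(_ l (rshift k c)) := X2.
  rewrite !mxE => XE; apply: etrans XE _; apply: eq_bigr => m _; rewrite mxE.
  by have [_ ->] := X1 m c (ltn_ord m) (ltn_ord c); rewrite s0E /= /mx_cell !valK.
split=> [i l l_lt|].
  by rewrite HE mxE entryE (hess_entry0 basis) // mxE.
pose Qc : 'M[C]_n := \matrix_(l, i) vec n s5 aQ i.+1 l 0.
exists (Qc^t* *m G); first by rewrite mul_unitarymx // unitary_columns.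
rewrite adjM trmxCK !mulmxA -[_ *m G *m A]mulmxA -[_ *m _ *m G^t*]mulmxA -A'E.
apply/matrixP=> i l; rewrite HE mxE entryE -mulmxA [LHS]mxE [RHS]mxE.
apply: eq_bigr => m _; rewrite [(A' *m _) m _]mxE [(A' *m _) m l]mxE !mxE.
by congr (_ * _); apply: eq_bigr => p _; rewrite !mxE.
Qed.

Local Open Scope complex_scope.
Local Open Scope sesquilinear_scope.

Theorem mainTheorem1 :
  exists (p : cmd) (c : nat),
    forall (R : realType) (n k : nat) (d : 'rV[R]_n) (U V : 'M[R[i]]_(n, k)),
      (1 <= k)%N -> (k <= n)%N ->
      let dC : 'rV[R[i]]_n := map_mx (real_complex R) d in
      let A : 'M[R[i]]_n := diag_mx dC + U *m V^t* in
      let s := exec p (init dC U V) in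
      let H : 'M[R[i]]_n := output n s in
      [/\ upper_hessenberg H,
          exists2 Q : 'M[R[i]]_n, Q \is unitarymx & H = Q *m A *m Q^t*
        & (ops s <= c * (n ^ 2 * k))%N].
Proof.
exists hessenberg_reduction, 1000%N => R n k d U V k_gt0 le_kn dC A s H.
have dC_real i : Num.conj (dC 0 i) = dC 0 i.
  by rewrite mxE; apply: conjc_real.
have [hess simQ] := hessenberg_reduction_correct U V dC_real.
by split=> //; apply: hessenberg_reduction_cost.
Qed.
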